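(* (1) $\operatorname{cof}^*_\omega(\mathscr I)=\mathfrak c$ when $\mathscr I$ is any of $\mathcal R,\ \mathcal S,\ \mathrm{conv},\ \mathcal{ED},\ \mathcal{ED}_{\mathrm{fin}},\ \mathscr I_L$. (2) $\operatorname{cof}^*_\omega(\mathrm{Fin}\otimes\mathrm{Fin})=\mathfrak d$. (3) $\operatorname{cof}^*_\omega(\mathrm{nwd})=\operatorname{cof}(\mathcal M)$.
   Context: For an ideal $\mathscr I$ on a countable set, $\operatorname{cof}^*_\omega(\mathscr I)=\min\{|\mathcal A|:\mathcal A\subseteq[\mathscr I]^\omega,\ \forall\overline B\in[\mathscr I]^\omega\,\exists\overline A\in\mathcal A\,\forall B\in\overline B\,\exists A\in\overline A\ B\subseteq^*A\}$, where $[\mathscr I]^\omega$ is the set of countably infinite subsets of $\mathscr I$ and $\subseteq^*$ is inclusion modulo finite. $\mathfrak c=2^{\aleph_0}$, $\mathfrak d$ is the dominating number, $\operatorname{cof}(\mathcal M)$ is the cofinality of the meager ideal. Ideals: $\mathcal R$ is the ideal on $\omega$ generated by the homogeneous sets (cliques and independent sets) of Rado's random graph on $\omega$. $\mathcal S$ is the ideal on $\Omega=\{U\subseteq2^\omega:U\text{ clopen of Lebesgue measure }1/2\}$ generated by the subsets of $\Omega$ with nonempty intersection. $\mathrm{conv}$ is the ideal on $\mathbb Q\cap[0,1]$ generated by the sequences in $\mathbb Q\cap[0,1]$ that converge (in $[0,1]$). $\mathcal{ED}=\{A\subseteq\omega\times\omega:\exists k\,\forall^\infty n\ |\{m:\langle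 n,m\rangle\in A\}|\le k\}$; $\mathcal{ED}_{\mathrm{fin}}$ is the restriction of $\mathcal{ED}$ to $\{(n,m):m\le n\}$. $\mathscr I_L=\{A\subseteq\omega:\exists k<\omega\,\forall^\infty i<\omega\ |A\cap P_i|\le k\cdot i\}$, where $(P_i)_{i<\omega}$ is the interval partition of $\omega$ with $|P_i|=2^i$. $\mathrm{Fin}\otimes\mathrm{Fin}=\{A\subseteq\omega\times\omega:\forall^\infty n\ |\{m:\langle n,m\rangle\in A\}|<\omega\}$. $\mathrm{nwd}$ is the ideal of nowhere dense subsets of $2^{<\omega}$ ($A$ is nowhere dense iff every $s\in2^{<\omega}$ has an extension $t\in2^{<\omega}$ no extension of which belongs to $A$). *)

(* Defs.v *)
From HB Require Import structures.
From mathcomp Require Import all_boot all_order all_algebra.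
From mathcomp Require Import all_classical all_reals all_analysis.
Set Implicit Arguments.
Unset Strict Implicit.
Unset Printing Implicit Defensive.
Import Order.TTheory GRing.Theory Num.Theory numFieldNormedType.Exports.
Local Open Scope classical_set_scope.
Local Open Scope card_scope.
Local Open Scope ring_scope.

(** * Cardinal invariants *)

(* [min_card P K]: the minimum of the cardinals of the families satisfying [P]
   exists and is the cardinal of [K]. The library only has the comparisons
   [#<=] and [#=] of sets, so a cardinal is given by a representative [K]. *)
Definition min_card (T U : Type) (P : set (set T)) (K : set U) : Prop :=
  (exists2 F, P F & F #= K) /\ (forall F, P F -> K #<= F).

Definition continuum : set (set nat) := [set: set nat].

Definition subset_mod_fin (X : Type) (A B : set X) : Prop :=
  finite_set (A `\` B).

Definition omega_subsets (T : Type) (I : set T) : set (set T) :=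
  [set C | C `<=` I /\ C #= [set: nat]].

Definition star_omega_cofinal (X : Type) (I : set (set X)) :
    set (set (set (set X))) :=
  [set F | F `<=` omega_subsets I /\
    forall Bs, omega_subsets I Bs -> exists2 As, F As &
      forall B, Bs B -> exists2 A, As A & subset_mod_fin B A].

Definition cof_star_omega (X U : Type) (I : set (set X)) (K : set U) : Prop :=
  min_card (star_omega_cofinal I) K.

Definition dominating : set (set (nat -> nat)) :=
  [set D | forall f : nat -> nat, exists2 g, D g &
    \forall n \near \oo, (f n <= g n)%N].

Definition dominating_number (U : Type) (K : set U) : Prop :=
  min_card dominating K.

Definition cofinal_in (X : Type) (I : set (set X)) : set (set (set X)) :=
  [set F | F `<=` I /\ forall B, I B -> exists2 A, F A & B `<=` A].

Definition cof (X U : Type) (I : set (set X)) (K : set U) : Prop :=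
  min_card (cofinal_in I) K.

Definition nowhere_dense (T : topologicalType) (A : set T) : Prop :=
  interior (closure A) = set0.

Definition meager (T : topologicalType) : set (set T) :=
  [set A | exists2 F : nat -> set T,
    (forall n, nowhere_dense (F n)) & A `<=` \bigcup_n F n].

(** * Ideals *)

Definition ideal (X : Type) (I : set (set X)) : Prop :=
  [/\ forall A, finite_set A -> I A,
      forall A B, A `<=` B -> I B -> I A
    & forall A B, I A -> I B -> I (A `|` B)].

Definition generated_ideal (X : Type) (G : set (set X)) : set (set X) :=
  smallest (@ideal X) G.

(* The restriction of an ideal to [D], as an ideal on the subtype of [D]. *)
Definition restrict_ideal (X : Type) (I : set (set X)) (D : set X) :
    set (set D) :=
  [set A | I (set_val @` A)].

(* The extension property characterizes Rado's graph up to isomorphism among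
   the graphs on [nat]. *)
Definition rado_graph (E : rel nat) : Prop :=
  [/\ irreflexive E, symmetric E &
    forall A B : set nat, finite_set A -> finite_set B -> A `&` B = set0 ->
      exists n, [/\ ~ A n, ~ B n, forall a, A a -> E n a
                  & forall b, B b -> ~~ E n b]].

Definition clique (E : rel nat) (H : set nat) : Prop :=
  forall x y, H x -> H y -> x <> y -> E x y.

Definition independent (E : rel nat) (H : set nat) : Prop :=
  forall x y, H x -> H y -> x <> y -> ~~ E x y.

Definition random_graph_ideal (E : rel nat) : set (set nat) :=
  generated_ideal [set H | clique E H \/ independent E H].

Definition cylinder (s : seq bool) : set cantor_space :=
  [set x | mkseq x (size s) = s].

(* Lebesgue measure on the Cantor space, as the outer measure that gives
   weight [2 ^- size s] to [cylinder s]. *)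
Definition cantor_measure (R : realType) (A : set cantor_space) : \bar R :=
  ereal_inf [set (\sum_(0 <= k <oo) ((2^-1 : R) ^+ size (s k))%:E)%E |
    s in [set s : nat -> seq bool | A `<=` \bigcup_k cylinder (s k)]].

Definition Omega (R : realType) : set (set cantor_space) :=
  [set U | clopen U /\ cantor_measure R U = (2^-1)%:E].

Definition solecki_ideal (R : realType) : set (set (Omega R)) :=
  generated_ideal
    [set A : set (Omega R) | \bigcap_(U in A) set_val U !=set0].

Definition rat01 : set rat := [set q | 0 <= q <= 1].

Definition conv_ideal (R : realType) : set (set rat01) :=
  generated_ideal
    [set A : set rat01 | exists2 x : nat -> rat01, A = range x &
      exists2 l : R, 0 <= l <= 1 &
        (fun n => ratr (set_val (x n)) : R) @ \oo --> l].

Definition ED : set (set (nat * nat)) :=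
  [set A | exists k : nat, \forall n \near \oo, [set m | A (n, m)] #<= `I_k].

Definition ED_fin :=
  @restrict_ideal _ ED [set p : nat * nat | (p.2 <= p.1)%N].

Definition block (i : nat) : set nat :=
  [set n | (2 ^ i - 1 <= n < 2 ^ i.+1 - 1)%N].

Definition linear_ideal : set (set nat) :=
  [set A | exists k : nat, \forall i \near \oo,
    A `&` block i #<= `I_(k * i)%N].

Definition FinxFin : set (set (nat * nat)) :=
  [set A | \forall n \near \oo, finite_set [set m | A (n, m)]].

Definition nwd : set (set (seq bool)) :=
  [set A | forall s, exists2 t, prefix s t & forall u, prefix t u -> ~ A u].

(* Main.v *)
Require Import Defs.
From mathcomp Require Import all_boot all_order all_algebra.
From mathcomp Require Import all_classical all_reals all_analysis.
From mathcomp Require Import lra.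
Set Implicit Arguments.
Unset Strict Implicit.
Unset Printing Implicit Defensive.
Import Order.TTheory GRing.Theory Num.Theory numFieldNormedType.Exports.
Local Open Scope classical_set_scope.
Local Open Scope card_scope.
Local Open Scope ring_scope.

(** (1) [[I]^omega] has at most [c] elements. Conversely each of the ideals
    contains sets [B x] (for [x] in [2^omega]) such that every [A] in the ideal
    almost contains only finitely many of them: graphs of the maps coding the
    restrictions of [x] (thickened for the linear ideal), sequences converging to distinct reals, the sets
    [{U | x \in U}], or branches of a copy of the comparability graph of
    [2^<omega] in Rado's graph. A cofinal family [F] hence yields a map from
    [2^omega] to [F] with countable fibres, and [c ^ omega = c] gives
    [c <= |F|].

    (2) Countably many sets of [Fin (x) Fin] are governed by countably many
    functions, which have a common bound modulo finite.

    (3) If the tree of a closed nowhere dense set is almost contained in the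
    nowhere dense set [A], then the closed set is included in the meager set of
    the branches that are eventually in [A]. Conversely, nowhere dense subsets
    of [2^<omega] and meager subsets of [2^omega] are both bounded by sets
    given by an interval partition and a real, and the inclusion of two such
    meager sets entails the inclusion modulo finitely many blocks of the
    partitions, hence that of the nowhere dense sets. *)

(** * Cardinals *)

Lemma card_le_inj (T U : Type) (A : set T) (B : set U) (f : T -> U) :
  (forall x, A x -> B (f x)) ->
  (forall x y, A x -> A y -> f x = f y -> x = y) -> A #<= B.
Proof.
move=> fAB finj; have Af : f @` A #= A.
  by apply: inj_card_eq => x y; rewrite !inE; exact: finj.
apply: (@card_le_trans _ _ _ (f @` A)).
  by move: (card_esym Af); rewrite card_eq_le => /andP[].
by apply: subset_card_le => _ [x Ax <-]; exact: fAB.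
Qed.

(* A maximal set of points of the product of the family on which all the
   projections are injective has a surjective projection: otherwise a point
   missed in every coordinate could be added. *)
Lemma exists_min_card (T : Type) (P : set (set T)) :
  P !=set0 -> exists2 F, P F & forall G, P G -> F #<= G.
Proof.
move=> [F0 PF0].
pose inj (S : set ({G | P G} -> T)) :=
  (forall f G, S f -> sval G (f G)) /\
  (forall f g G, S f -> S g -> f G = g G -> f = g).
have [S [[Sval Sinj] Smax]] : exists S, inj S /\ forall S', S `<` S' -> ~ inj S'.
  apply: Zorn_bigcup => SS SSinj SStot; split.
    by move=> f G [S1 SS1 S1f]; have [+ _] := SSinj _ SS1; apply.
  move=> f g G [S1 SS1 S1f] [S2 SS2 S2g].
  have [S12|S21] := SStot _ _ SS1 SS2.
    by have [_] := SSinj _ SS2; apply => //; exact: S12.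
  by have [_] := SSinj _ SS1; apply => //; exact: S21.
have [[F Fsurj]|noF] := pselect (exists F, sval F `<=` (fun f => f F) @` S).
  exists (sval F) => [|G PG]; first exact: svalP.
  apply: (card_le_trans (subset_card_le Fsurj)).
  apply: (card_le_trans (card_image_le _ _)).
  apply: (@card_le_inj _ _ _ _ (fun f => f (exist _ G PG))) => [f|f g Sf Sg].
    exact: Sval (exist _ G PG).
  exact: Sinj.
have /choice[h hP] : forall F : {G | P G}, exists y,
    sval F y /\ forall f, S f -> f F <> y.
  move=> F; apply: contrapT => nex; apply: noF; exists F => y Fy.
  apply: contrapT => nS; apply: nex; exists y; split=> // f Sf fy.
  by apply: nS; exists f.
exfalso; apply: (Smax (S `|` [set h])).
  split; first by move=> f; left.
  move=> /(_ h (or_intror erefl)) Sh.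
  by have [_ /(_ _ Sh)] := hP (exist _ F0 PF0).
split=> [f G [/Sval|->]|f g G]; [exact | by have [] := hP G |].
move=> [Sf|->] [Sg|->] //; first exact: Sinj.
  by have [_ /(_ _ Sf)] := hP G.
by have [_ /(_ _ Sg) + /esym] := hP G.
Qed.

Lemma card_powerset (T : Type) : [set: set T] #= [set: T -> bool].
Proof.
rewrite card_eq_le; apply/andP; split.
  apply: (@card_le_inj _ _ _ _ (fun A x => `[< A x >])) => // A B _ _ AB.
  apply/funext => x; have := congr1 (fun f => f x) AB => /=.
  by move=> ABx; apply/propext; exact: (asbool_eq_equiv ABx).
apply: (@card_le_inj _ _ _ _ (fun f : T -> bool => [set x | f x])) => // f g _ _ fg.
apply/funext => x; have /propeqP[] := congr1 (fun f => f x) fg.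
by move=> fgx gfx; apply/idP/idP.
Qed.

(* Koenig's argument: if a set of cardinal [c = c ^ omega] is covered by
   countably many pieces, one of them has cardinal [c], as otherwise one could
   diagonalize against the pieces. *)
Lemma continuum_le (T : Type) (F : set T) (phi : (nat -> bool) -> T) :
  (forall x, F (phi x)) -> (forall t, countable [set x | phi x = t]) ->
  continuum #<= F.
Proof.
move=> Fphi phi_fib.
have /choice[e e_inj] : forall t, exists e : (nat -> bool) -> nat,
    {in [set x | phi x = t] &, injective e}.
  by move=> t; apply/countable_injP.
(* The countably many pieces are the fibres of [num], on each of which [phi] is injective. *)
pose num x := e (phi x) x.
have num_inj x y : phi x = phi y -> num x = num y -> x = y.
  by rewrite /num => xy; rewrite xy; apply: e_inj; rewrite inE.
pose coord (n : nat) (x : nat -> bool) : nat -> bool := fun m => x (pickle (n, m)).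
have [n nsurj] : exists n, forall y, exists2 x, num x = n & coord n x = y.
  apply: contrapT => nex.
  have /choice[y yP] : forall n, exists y, forall x, num x = n -> coord n x <> y.
    move=> n; apply: contrapT => ney; apply: nex; exists n => y.
    apply: contrapT => nx; apply: ney; exists y => x xn xy.
    by apply: nx; exists x.
  (* The missed points [y n] are glued into one point, whose coordinate of index [num x] contradicts
     the choice of [y]. *)
  pose x k := if @unpickle (nat * nat)%type k is Some (n, m) then y n m
              else false.
  apply: (yP (num x) x erefl); apply/funext => m.
  by rewrite /coord /x pickleK.
have /choice[s sP] : forall y, exists x, num x = n /\ coord n x = y.
  by move=> y; have [x] := nsurj y; exists x.
have /card_eqPle[cb _] := card_powerset nat.
apply: (card_le_trans cb); apply: (@card_le_inj _ _ _ _ (phi \o s)) => //= x y.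
move=> _ _ xy; have [[sx <-] [sy <-]] := (sP x, sP y).
by congr coord; apply: num_inj => //; rewrite sx sy.
Qed.

Lemma denumerable_range (T : Type) (C : set T) :
  C #= [set: nat] -> exists e : nat -> T, C = range e.
Proof.
move=> Ceq; have /card_eqPle[/pfcard_geP[C0 _|/surjfunPex]//] := Ceq.
by case: infinite_nat; rewrite -(eq_finite_set Ceq) C0.
Qed.

(** Cofinality is tested on infinite families only; the singletons turn any countable test family,
    even a single set, into an infinite one. *)
Lemma omega_subsets_extend (X : Type) (I C : set (set X)) :
  countable [set: X] -> infinite_set [set: X] -> (forall x, I [set x]) ->
  countable C -> C `<=` I -> omega_subsets I (C `|` range set1).
Proof.
move=> Xcnt Xinf I1 Ccnt CI; split.
  by move=> A [/CI//|[x _ <-]].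
apply: eq_card_nat.
  rewrite -bigcup2E; apply: bigcup_countable => [|[|[|n]] _] //=.
  exact: card_le_trans (card_image_le _ _) Xcnt.
move=> /(sub_finite_set (@subsetUr _ _ _)).
apply: contra_not Xinf; apply: card_le_finite.
apply: (@card_le_inj _ _ _ _ set1) => // x y _ _ xy.
by rewrite -[x = y]/([set y] x) -xy.
Qed.

(** A family is recovered from a chosen enumeration, and an enumeration is a subset of [nat * X],
    coded as a set of integers. *)
Lemma omega_subsets_le_continuum (X : Type) (I : set (set X)) :
  countable [set: X] -> omega_subsets I #<= continuum.
Proof.
move=> /countable_injP[i i_inj].
have {}i_inj : injective i by move=> x y; apply: i_inj; rewrite inE.
have /choice[e eP] : forall C : set (set X), exists e : nat -> set X,
    C #= [set: nat] -> C = range e.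
  move=> C; have [/denumerable_range[e ->]|nC] := pselect (C #= [set: nat]).
    by exists e.
  by exists (fun=> set0).
pose code C : set nat := [set k | exists n x, k = pickle (n, i x) /\ e C n x].
have codeE C n x : code C (pickle (n, i x)) = e C n x.
  apply/propext; split=> [|enx]; last by exists n, x.
  by move=> [m [y [/(pcan_inj pickleK)[-> /i_inj ->]]]].
apply: (@card_le_inj _ _ _ _ code) => // C D [_ Ceq] [_ Deq] CD.
rewrite (eP _ Ceq) (eP _ Deq); suff -> : e C = e D by [].
by apply/funext => n; apply/funext => x; rewrite -!codeE CD.
Qed.

(** Common criterion for all of (1). Let [phi x] be a family of [F] with a member almost containing
    [B x]: the family is countable and each member serves finitely many [x], so [phi] has countable
    fibres. *)
Lemma cof_star_omega_continuum (X : Type) (I : set (set X))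
    (B : (nat -> bool) -> set X) :
  countable [set: X] -> infinite_set [set: X] -> (forall x, I [set x]) ->
  (forall x, I (B x)) ->
  (forall A, I A -> finite_set [set x | subset_mod_fin (B x) A]) ->
  cof_star_omega I continuum.
Proof.
move=> Xcnt Xinf I1 IB Bfin.
have lower F : star_omega_cofinal I F -> continuum #<= F.
  move=> [FI Fcof].
  have /choice[phi phiP] : forall x, exists As, F As /\
      exists2 A, As A & subset_mod_fin (B x) A.
    move=> x; have [|As FAs AsP] := Fcof ([set B x] `|` range set1).
      by apply: omega_subsets_extend => // A ->.
    by exists As; split=> //; apply: AsP; left.
  apply: (@continuum_le _ F phi) => [x|As]; first by have [] := phiP x.
  have [FAs|nF] := pselect (F As); last first.
    apply: (sub_countable _ (countable0 (nat -> bool))).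
    apply: subset_card_le => x /= xAs; apply: nF; rewrite -xAs.
    by have [] := phiP x.
  have [AsI Asnat] := FI _ FAs.
  apply: (@sub_countable _ _ _
      (\bigcup_(A in As) [set x | subset_mod_fin (B x) A])).
    apply: subset_card_le => x /= <-; have [_ [A AsA BA]] := phiP x.
    by exists A.
  apply: bigcup_countable => [|A /AsI /Bfin]; last exact: finite_set_countable.
  by have /card_eqPle[] := Asnat.
have cofI : star_omega_cofinal I (omega_subsets I).
  split=> // Bs BsI; exists Bs => // A BsA; exists A => //.
  by rewrite /subset_mod_fin setDv.
split=> //; exists (omega_subsets I) => //.
by rewrite card_eq_le omega_subsets_le_continuum//=; exact: lower.
Qed.

(** A member [K] of [P] of least cardinal exists, and the two translations, which do not increase
    cardinals, make it the minimum for [Q] too. *)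
Lemma min_card_transfer (T U : Type) (P : set (set T)) (Q : set (set U)) :
  P !=set0 ->
  (forall F, P F -> exists2 G, Q G & G #<= F) ->
  (forall G, Q G -> exists2 F, P F & F #<= G) ->
  exists K : set T, min_card P K /\ min_card Q K.
Proof.
move=> /exists_min_card[K PK Kmin] PQ QP; exists K.
have KQ G : Q G -> K #<= G.
  by move=> /QP[F PF]; apply: card_le_trans; exact: Kmin.
split; split=> //; first by exists K.
have [G QG GK] := PQ _ PK; exists G => //.
by rewrite card_eq_le GK KQ.
Qed.

(** * The ideal Fin (x) Fin *)

Lemma finite_nat_bound (A : set nat) :
  finite_set A -> exists M, forall m, A m -> (m <= M)%N.
Proof.
move=> /finite_seqP[s ->]; exists (\max_(i <- s) i) => m /= ms.
exact: leq_bigmax_seq.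
Qed.

Lemma leq_bigmax_upto (h : nat -> nat) (i n : nat) :
  (i <= n)%N -> (h i <= \max_(j < n.+1) h j)%N.
Proof.
by rewrite -ltnS => lt_in; exact: (@leq_bigmax _ (h \o val) (Ordinal lt_in)).
Qed.

Lemma dominating_setT : dominating [set: nat -> nat].
Proof. by move=> f; exists f => //; exists 0. Qed.

Lemma FinxFin_bound (A : set (nat * nat)) : FinxFin A ->
  exists (N : nat) (h : nat -> nat),
    forall n m, (N <= n)%N -> A (n, m) -> (m <= h n)%N.
Proof.
move=> [N _ NA].
have /choice[h hP] : forall n, exists M, (N <= n)%N ->
    forall m, A (n, m) -> (m <= M)%N.
  move=> n; have [Nn|nN] := leqP N n; last by exists 0.
  by have [M MP] := finite_nat_bound (NA n Nn); exists M.
by exists N, h => n m Nn; exact: hP.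
Qed.

Lemma star_omega_cofinal_of_dominating (D : set (nat -> nat)) :
  dominating D -> exists2 F, star_omega_cofinal FinxFin F & F #<= D.
Proof.
move=> Ddom.
(* The first [k] columns in full, and the region under [g]: varying [k] absorbs any finite number of
   bad columns. *)
pose A (g : nat -> nat) (k : nat) : set (nat * nat) :=
  [set p | (p.1 < k)%N \/ (p.2 <= g p.1)%N].
have A_FinxFin g k : FinxFin (A g k).
  exists k => // n /= kn; apply: (@sub_finite_set _ _ `I_(g n).+1) => //.
  by move=> m [/=|//]; rewrite ltnNge kn.
have A_inj g : injective (A g).
  move=> k l Akl; apply/eqP; rewrite eqn_leq.
  have lek i j : A g i = A g j -> (i <= j)%N.
    move=> Aij; rewrite leqNgt; apply/negP => ji.
    have : A g j (j, (g j).+1) by rewrite -Aij; left.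
    by move=> [] /=; rewrite ltnn.
  by rewrite !lek.
exists ((fun g => range (A g)) @` D); last exact: card_image_le.
split=> [_ [g Dg <-]|Bs [BsI /denumerable_range[b Bsb]]].
  split; first by move=> _ [k _ <-].
  by apply: inj_card_eq => k l _ _; exact: A_inj.
have /choice[N /choice[h NhP]] i : exists (N : nat) (h : nat -> nat),
    forall n m, (N <= n)%N -> b i (n, m) -> (m <= h n)%N.
  by apply: FinxFin_bound; apply: BsI; rewrite Bsb; exists i.
have [g Dg [M _ Mg]] := Ddom (fun n => \max_(i < n.+1) h i n).
exists (range (A g)); first by exists g.
(* From this column on, [g] dominates the diagonal maximum, [h i] takes part in it, and [h i] bounds
   [b i]. *)
rewrite Bsb => _ [i _ <-]; exists (A g (maxn M (maxn i (N i)))).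
  by exists (maxn M (maxn i (N i))).
rewrite /subset_mod_fin (_ : _ `\` _ = set0) //.
apply/seteqP; split=> // -[n m] [bnm]; apply; rewrite /A /=.
have [|] := ltnP n (maxn M (maxn i (N i))); first by left.
rewrite !geq_max => /and3P[Mn li Nn]; right.
apply: leq_trans (Mg n Mn); apply: leq_trans (NhP i n m Nn bnm) _.
exact: (leq_bigmax_upto (h^~ n) li).
Qed.

(** An enumerated family is sent to the diagonal maximum of the bounds of its members. Testing on
    the region under [f] shows that one of these maxima dominates [f]. *)
Lemma dominating_of_star_omega_cofinal (F : set (set (set (nat * nat)))) :
  star_omega_cofinal FinxFin F -> exists2 D, dominating D & D #<= F.
Proof.
move=> [FI Fcof].
have /choice[h hP] : forall A : set (nat * nat), exists h : nat -> nat,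
    FinxFin A -> \forall n \near \oo, forall m, A (n, m) -> (m <= h n)%N.
  move=> A; have [/FinxFin_bound[N [h NhP]]|nA] := pselect (FinxFin A).
    by exists h => _; exists N => // n /= Nn m; exact: NhP.
  by exists id.
have /choice[e eP] : forall As : set (set (nat * nat)),
    exists e : nat -> set (nat * nat), F As -> As = range e.
  move=> As; have [/FI[_ /denumerable_range[e]]|nF] := pselect (F As).
    by exists e.
  by exists (fun=> set0).
exists ((fun As n => \max_(i < n.+1) h (e As i) n) @` F);
  last exact: card_image_le.
move=> f; pose B := [set p : nat * nat | (p.2 <= f p.1)%N].
have [|As FAs AsP] := Fcof ([set B] `|` range set1).
  apply: omega_subsets_extend => //; first exact: infinite_prod_nat.
    move=> [i j]; exists 0 => // n _; apply: (@sub_finite_set _ _ [set j]) => //.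
    by move=> m [].
  move=> _ ->; exists 0 => // n _.
  exact: (@sub_finite_set _ _ `I_(f n).+1).
exists (fun n => \max_(i < n.+1) h (e As i) n); first by exists As.
have [A AsA Bfin] := AsP B (or_introl erefl).
have [i _ eA] : range (e As) A by rewrite -(eP _ FAs).
rewrite -{A AsA}eA in Bfin.
have /hP[N _ NP] : FinxFin (e As i).
  by have [+ _] := FI _ FAs; apply; rewrite [X in X _](eP _ FAs); exists i.
have /finite_nat_bound[M MP] := finite_image fst Bfin.
exists (maxn N (maxn i M.+1)) => // n /=; rewrite !geq_max => /and3P[Nn li Mn].
apply: leq_trans (leq_bigmax_upto (fun i => h (e As i) n) li).
apply: (NP n Nn); apply: contrapT => nA; move: Mn; rewrite ltnNge => /negP; apply.
by apply: MP; exists (n, f n) => //; split=> //; rewrite /B /=.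
Qed.

Lemma cof_star_omega_FinxFin : exists K : set (nat -> nat),
  dominating_number K /\ cof_star_omega FinxFin K.
Proof.
apply: min_card_transfer.
- by exists setT; exact: dominating_setT.
- exact: star_omega_cofinal_of_dominating.
- exact: dominating_of_star_omega_cofinal.
Qed.

(** * The Cantor space *)

Lemma mkseq_prefix (x : nat -> bool) (m n : nat) :
  (m <= n)%N -> prefix (mkseq x m) (mkseq x n).
Proof.
move=> mn; rewrite prefixE size_mkseq; apply/eqP.
have szm : size (take m (mkseq x n)) = m by rewrite size_takel ?size_mkseq.
apply: (@eq_from_nth _ false); rewrite szm ?size_mkseq// => i im.
by rewrite nth_take// !nth_mkseq// (leq_trans im).
Qed.

Lemma cylinderP (s : seq bool) (x : cantor_space) :
  cylinder s x <-> forall i, (i < size s)%N -> x i = nth false s i.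
Proof.
split=> [xs i si|xs]; first by rewrite -xs nth_mkseq.
apply: (@eq_from_nth _ false); rewrite size_mkseq// => i si.
by rewrite nth_mkseq// xs.
Qed.

Lemma cylinder_mkseqP (y x : cantor_space) (n : nat) :
  cylinder (mkseq y n) x <-> forall i, (i < n)%N -> x i = y i.
Proof.
split=> [/cylinderP + i i_n|xy].
  by rewrite size_mkseq => /(_ i i_n) ->; rewrite nth_mkseq.
by apply/cylinderP => i; rewrite size_mkseq => i_n; rewrite nth_mkseq// xy.
Qed.

Lemma cylinder_mkseq (x : cantor_space) (n : nat) : cylinder (mkseq x n) x.
Proof. exact/cylinder_mkseqP. Qed.

Lemma cylinder_nth (s : seq bool) : cylinder s (nth false s : cantor_space).
Proof. exact/cylinderP. Qed.

Lemma subset_cylinder (s t : seq bool) :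
  prefix s t -> cylinder t `<=` cylinder s.
Proof.
move=> /prefixP[u ->] x /cylinderP xt; apply/cylinderP => i si.
by rewrite xt ?nth_cat ?si// size_cat ltn_addr.
Qed.

Lemma nbhs_cylinder (x : cantor_space) (U : set cantor_space) :
  nbhs x U -> exists n, cylinder (mkseq x n) `<=` U.
Proof.
pose F : set_system cantor_space :=
  filter_from [set: nat] (fun n => cylinder (mkseq x n)).
have FF : Filter F.
  apply: filter_from_filter; first by exists 0.
  move=> i j _ _; exists (maxn i j) => // y /cylinder_mkseqP yx.
  by split; apply/cylinder_mkseqP => k ki; rewrite yx// leq_max ki ?orbT.
suff /[apply] : F --> x by move=> [n _ nU]; exists n.
(* The product topology is a supremum over the coordinates, so convergence is checked on each of
   them; a cylinder of length [i.+1] fixes coordinate [i]. *)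
apply/cvg_sup => i; apply/cvg_image => //.
  by rewrite eqEsubset; split=> b // _; exists (fun=> b).
move=> W /nbhs_singleton Wxi.
exists ((fun y : cantor_space => y i) @^-1` W); last first.
  by rewrite image_preimage// eqEsubset; split=> b // _; exists (fun=> b).
by exists i.+1 => // y /cylinder_mkseqP/(_ i (ltnSn i)) /= ->.
Qed.

Lemma clopen_cylinder (s : seq bool) : clopen (cylinder s).
Proof.
elim/last_ind: s => [|s b IHs].
  rewrite (_ : cylinder [::] = setT); first exact: clopenT.
  by apply/seteqP; split=> // x _; exact/cylinderP.
rewrite (_ : cylinder _ = cylinder s `&`
    ((fun x : cantor_space => x (size s)) @^-1` [set b])).
  apply: clopenI IHs _; apply: preimage_clopen.
    by split; [exact: discrete_open | exact: discrete_closed].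
  exact: (@proj_continuous nat (fun=> bool) (size s)).
apply/seteqP; split=> x => [/cylinderP xsb|[/cylinderP xs /= xb]].
  split; first apply/cylinderP => i si.
    by rewrite xsb ?size_rcons ?ltnS 1?ltnW// nth_rcons si.
  by rewrite /= xsb ?size_rcons// nth_rcons ltnn eqxx.
apply/cylinderP => i; rewrite size_rcons ltnS leq_eqVlt => /predU1P[->|si].
  by rewrite nth_rcons ltnn eqxx.
by rewrite nth_rcons si xs.
Qed.

Lemma cylinder_nbhs (s : seq bool) (x : cantor_space) :
  cylinder s x -> nbhs x (cylinder s).
Proof.
move=> sx; apply: open_nbhs_nbhs; split=> //.
by have [] := clopen_cylinder s.
Qed.

(** The set of nodes is the tree of initial segments of [N]: this is the bridge between 2^omega and
    2^<omega. *)
Lemma nowhere_dense_nwdP (N : set cantor_space) :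
  nowhere_dense N <-> nwd [set s | cylinder s `&` N !=set0].
Proof.
split=> [Nnd s|Nnwd].
  have [y [ys Ny]] : exists y, cylinder s y /\ ~ closure N y.
    apply: contrapT => nex.
    suff : interior (closure N) (nth false s : cantor_space) by rewrite Nnd.
    apply: filterS (cylinder_nbhs (cylinder_nth s)) => y ys.
    by apply: contrapT => Ny; apply: nex; exists y.
  have [U] : exists U, nbhs y U /\ ~ (N `&` U !=set0).
    by apply: contrapT => nex; apply: Ny => U yU; apply: contrapT => NU;
      apply: nex; exists U.
  move=> [/nbhs_cylinder[n nU] NU].
  exists (mkseq y (maxn n (size s))).
    by rewrite -{1}ys; apply: mkseq_prefix; rewrite leq_maxr.
  move=> u tu [z [zu Nz]]; apply: NU; exists z; split=> //; apply: nU.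
  apply: (subset_cylinder _ zu); apply: prefix_trans tu.
  by apply: mkseq_prefix; rewrite leq_maxl.
apply/seteqP; split=> // x /nbhs_cylinder[n nN].
have [t st tN] := Nnwd (mkseq x n).
have [y [Ny yt]] := nN _ (subset_cylinder st (cylinder_nth t)) _
  (cylinder_nbhs (cylinder_nth t)).
by apply: (tN t); [exact: prefix_refl | exists y].
Qed.

(** * Nowhere dense subsets of the binary tree *)

Lemma nwd_sub (A B : set (seq bool)) : A `<=` B -> nwd B -> nwd A.
Proof.
move=> AB Bnwd s; have [t st tB] := Bnwd s; exists t => // u tu.
by move=> /AB; exact: tB.
Qed.

Lemma nwd_set1 (s : seq bool) : nwd [set s].
Proof.
move=> r; exists (r ++ rcons s true); first exact: prefix_prefix.
move=> u /size_prefix + us; rewrite us size_cat size_rcons addnS.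
by rewrite ltnNge leq_addl.
Qed.

Lemma infinite_seq_bool : infinite_set [set: seq bool].
Proof.
apply/infiniteP; apply: (@card_le_inj _ _ _ _ (fun n => nseq n true)) => //.
by move=> m n _ _ /(congr1 size); rewrite !size_nseq.
Qed.

(** * Meager sets and interval partitions *)

Lemma meager_sub (T : topologicalType) (A B : set T) :
  A `<=` B -> meager B -> meager A.
Proof. by move=> AB [F Fnd BF]; exists F => //; apply: subset_trans BF. Qed.

Lemma meager_bigcup (T : topologicalType) (M : nat -> set T) :
  (forall n, meager (M n)) -> meager (\bigcup_n M n).
Proof.
move=> /(_ _)/cid2-/all_sig2[F Fnd MF].
exists (fun k => if @unpickle (nat * nat)%type k is Some (n, m) then F n m
                 else set0) => [k|x [n _ /MF[m _ Fx]]].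
  case: unpickle => [[n m]|]; first exact: Fnd.
  by rewrite /nowhere_dense closure0 interior0.
by exists (pickle (n, m)) => //; rewrite pickleK.
Qed.

(* The [k]-th block of the partition given by [a] is the interval from [a k] to
   [a k.+1 - 1]. *)
Definition agree (a : nat -> nat) (z : nat -> bool) (k : nat)
    (x : nat -> bool) : Prop :=
  forall i, (a k <= i < a k.+1)%N -> x i = z i.

Definition block_meager (a : nat -> nat) (z : nat -> bool) : set cantor_space :=
  [set x | \forall k \near \oo, ~ agree a z k x].

(** Only blocks that [u] covers entirely are tested. The sets grow with [k0], so one pair [a], [z]
    gives a countable family that absorbs errors on finitely many blocks. *)
Definition block_nwd (a : nat -> nat) (z : nat -> bool) (k0 : nat) :
    set (seq bool) :=
  [set u | forall k, (k0 <= k)%N -> (a k.+1 <= size u)%N ->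
     ~ agree a z k (nth false u)].

Definition increasing (a : nat -> nat) := forall k, (a k < a k.+1)%N.

Lemma increasing_leq (a : nat -> nat) : increasing a ->
  {homo a : m n / (m <= n)%N}.
Proof.
move=> a_inc m n; apply: (homo_leq leqnn leq_trans) => k; exact: ltnW.
Qed.

Lemma increasing_ge (a : nat -> nat) : increasing a -> forall k, (k <= a k)%N.
Proof.
by move=> a_inc; elim=> // k IHk; apply: leq_ltn_trans IHk (a_inc k).
Qed.

(** The finitely many pairs [(s, j)] are treated in turn: [w] is lengthened until nothing above
    [s ++ w] is in [B j], and this persists under further lengthening. *)
Lemma nwd_common_extension (B : nat -> set (seq bool)) (n k : nat) :
  (forall j, nwd (B j)) -> exists w : seq bool, (0 < size w)%N /\
    forall s j u, size s = n -> (j <= k)%N -> prefix (s ++ w) u -> ~ B j u.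
Proof.
move=> Bnwd.
have [w wP] : exists w : seq bool, forall (p : seq bool * nat),
    p \in [seq (tval t, j) | t <- enum {:n.-tuple bool}, j <- iota 0 k.+1] ->
    forall u, prefix (p.1 ++ w) u -> ~ B p.2 u.
  elim: [seq _ | _ <- _, _ <- _] => [|[s j] L [w wP]]; first by exists [::].
  have [_ /prefixP[v ->] vP] := Bnwd j (s ++ w).
  exists (w ++ v) => p; rewrite inE => /predU1P[-> u /=|/wP pP u].
    by rewrite catA; exact: vP.
  by rewrite catA => /catl_prefix; exact: pP.
(* The extra bit makes [w] nonempty, hence the blocks nonempty. *)
exists (w ++ [:: false]); split; first by rewrite size_cat addn1.
move=> s j u sn jk; rewrite catA => /catl_prefix; apply: (wP (s, j)).
apply/allpairsP; exists (tcast sn (in_tuple s), j).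
split; first by rewrite mem_enum.
  by rewrite mem_iota add0n ltnS.
by rewrite /= val_tcast.
Qed.

(** The [k]-th block of [z] is a word that forces nodes out of [B j] for all [j <= k], whatever
    precedes it; [st k] concatenates the first [k] words. *)
Lemma nwd_blocks (B : nat -> set (seq bool)) : (forall j, nwd (B j)) ->
  exists a z, increasing a /\ forall j, B j `<=` block_nwd a z j.
Proof.
move=> Bnwd.
have /choice[w wP] : forall p : nat * nat, exists w : seq bool,
    (0 < size w)%N /\ forall s j u, size s = p.1 -> (j <= p.2)%N ->
      prefix (s ++ w) u -> ~ B j u.
  by move=> p; exact: nwd_common_extension.
pose fix st k : seq bool :=
  if k is k'.+1 then st k' ++ w (size (st k'), k') else [::].
pose a k := size (st k); pose z i := nth false (st i.+1) i.
have a_inc : increasing a.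
  move=> k; rewrite /a /= size_cat -[X in (X < _)%N]addn0 ltn_add2l.
  by have [] := wP (size (st k), k).
have stE m n i : (m <= n)%N -> (i < a m)%N -> nth false (st n) i = nth false (st m) i.
  elim: n => [|n IHn]; first by rewrite leqn0 => /eqP ->.
  rewrite leq_eqVlt ltnS => /predU1P[->//|mn] im.
  by rewrite /= nth_cat (leq_trans im (increasing_leq a_inc mn)) IHn.
have zE k i : (i < a k)%N -> z i = nth false (st k) i.
  move=> ik; have ii : (i < a i.+1)%N by exact: increasing_ge.
  have [ki|/ltnW ik'] := leqP k i.+1; first exact: stE.
  exact/esym/stE.
exists a, z; split=> // j u Bu k jk ku uz.
have [_ wkP] := wP (a k, k); apply: (wkP (take (a k) u) j u) => //.
  by rewrite /= size_takel// (leq_trans (ltnW (a_inc k))).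
have sk : size (take (a k) u) = a k.
  by rewrite size_takel// (leq_trans (ltnW (a_inc k))).
rewrite prefixE size_cat sk; apply/eqP.
have ak1 : (a k + size (w (a k, k)) = a k.+1)%N by rewrite {3}/a /= size_cat.
apply: (@eq_from_nth _ false).
  by rewrite size_cat sk size_takel// ak1.
rewrite ak1 size_takel// => i ik; rewrite nth_take// nth_cat sk.
have [iak|aki] := ltnP i (a k); first by rewrite nth_take.
rewrite uz ?aki ?ik// (zE k.+1)//= nth_cat ltnNge.
by rewrite -/(a k) aki.
Qed.

Lemma block_nwd_nwd (a : nat -> nat) (z : nat -> bool) (k0 : nat) :
  increasing a -> nwd (block_nwd a z k0).
Proof.
move=> a_inc s; pose k := maxn k0 (size s).
have sk : (size s <= a k)%N.
  by apply: leq_trans (increasing_ge a_inc k); rewrite leq_maxr.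
(* [s] is prolonged by [z] up to the end of block [k], which starts after [s]. *)
exists (mkseq (fun i => if (i < size s)%N then nth false s i else z i) (a k.+1)).
  apply: prefix_trans (mkseq_prefix _ (leq_trans sk (ltnW (a_inc k)))).
  rewrite (_ : mkseq _ _ = s) ?prefix_refl//.
  apply: (@eq_from_nth _ false) => [|i]; first by rewrite size_mkseq.
  by rewrite size_mkseq => si; rewrite nth_mkseq// si.
move=> _ /prefixP[v ->] /(_ k); rewrite leq_maxl size_cat size_mkseq.
rewrite leq_addr => /(_ isT isT); apply=> i /andP[ki ik].
by rewrite nth_cat size_mkseq ik nth_mkseq// ltnNge (leq_trans sk ki).
Qed.

Lemma block_meager_meager (a : nat -> nat) (z : nat -> bool) :
  increasing a -> meager (block_meager a z).
Proof.
move=> a_inc.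
exists (fun m => [set x : cantor_space | forall k, (m <= k)%N -> ~ agree a z k x]).
  move=> m; apply/nowhere_dense_nwdP; apply: nwd_sub (block_nwd_nwd z m a_inc).
  move=> s [x [/cylinderP xs xm]] k mk ks sz; apply: (xm k mk) => i /andP[ki ik].
  by rewrite xs ?sz ?ki// (leq_trans ik).
by move=> x [m _ mx]; exists m.
Qed.

Lemma meager_blocks (M : set cantor_space) : meager M ->
  exists a z, increasing a /\ M `<=` block_meager a z.
Proof.
move=> [F Fnd MF].
have [j|a [z [a_inc Baz]]] :=
  @nwd_blocks (fun j => [set s | cylinder s `&` F j !=set0]).
  exact/nowhere_dense_nwdP.
exists a, z; split=> // x /MF[j _ Fx]; exists j => // k /= jk xz.
apply: (Baz j (mkseq x (a k.+1)) _ k jk); rewrite ?size_mkseq//.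
  by exists x; split=> //; exact: cylinder_mkseq.
by move=> i /[dup] /andP[_ ik] /xz <-; rewrite nth_mkseq.
Qed.

(* If infinitely many [b]-blocks contain no [a]-block on which [y] and [z]
   agree, let [x] be [y] on pairwise non adjacent such [b]-blocks and the
   complement of [z] elsewhere: an [a]-block on which [x] agrees with [z] would
   lie in one of the chosen [b]-blocks. *)
Lemma block_meager_sub (a b : nat -> nat) (z y : nat -> bool) :
  increasing a -> increasing b -> block_meager a z `<=` block_meager b y ->
  \forall k \near \oo, exists l, [/\ (b k <= a l)%N, (a l.+1 <= b k.+1)%N
    & agree a z l y].
Proof.
move=> a_inc b_inc ab; apply: contrapT => nnear.
pose bad k := ~ exists l, [/\ (b k <= a l)%N, (a l.+1 <= b k.+1)%N
    & agree a z l y].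
(* Infinitely many bad blocks share a parity; keeping only these, no two chosen blocks are
   adjacent. *)
have [e eP] : exists e : bool, forall N, exists k, [/\ (N <= k)%N, odd k = e & bad k].
  apply: contrapT => ne.
  have nN e : exists N, forall k, (N <= k)%N -> odd k = e -> ~ bad k.
    apply: contrapT => nN; apply: ne; exists e => N; apply: contrapT => nk.
    by apply: nN; exists N => k Nk ke bk; apply: nk; exists k.
  have [[N0 N0P] [N1 N1P]] := (nN false, nN true).
  apply: nnear; exists (maxn N0 N1) => // k /=; rewrite geq_max => /andP[k0 k1].
  apply: contrapT => bk; case: (boolP (odd k)) => [|/negbTE] ko.
    exact: (N1P k).
  exact: (N0P k).
pose chosen i k := [/\ odd k = e, bad k, (b k <= i)%N & (i < b k.+1)%N].
pose x : cantor_space := fun i => if `[< exists k, chosen i k >] then y i else ~~ z i.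
have x_chosen i : x i = z i -> exists k, chosen i k.
  by rewrite /x; case: asboolP => // _; case: (z i).
have [N _ NP] : block_meager b y x.
  apply: ab; exists 0 => // l _ xz.
  have [k [ke kbad kl lk]] : exists k, chosen (a l) k.
    by apply/x_chosen/xz; rewrite leqnn a_inc.
  (* If the [a]-block contained [b k.+1], that point would lie in a chosen block too, necessarily
     the adjacent one, of the wrong parity. *)
  have l1k : (a l.+1 <= b k.+1)%N.
    rewrite leqNgt; apply/negP => kl1.
    have [k' [k'e _ k'k kk']] : exists k', chosen (b k.+1) k'.
      by apply/x_chosen/xz; rewrite (ltnW lk) kl1.
    suff k'k1 : k' = k.+1 by move: k'e; rewrite k'k1 /= ke; case: (e).
    apply/eqP; rewrite eqn_leq; apply/andP; split; rewrite leqNgt; apply/negP.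
      move=> /(increasing_leq b_inc) /(leq_trans (b_inc _)).
      by rewrite ltnNge k'k.
    by move=> /(increasing_leq b_inc); rewrite leqNgt kk'.
  apply: (kbad); exists l; split=> // i /[dup] /andP[li il] /xz <-.
  rewrite /x asboolT//; exists k; split=> //; [exact: leq_trans li|exact: leq_trans l1k].
have [k [Nk ke kbad]] := eP N; apply: (NP k Nk) => i /andP[ki ik].
by rewrite /x asboolT//; exists k.
Qed.

(** Each [N] in [M] has a bounding pair, which gives the family of its sets [block_nwd]. Countably
    many nowhere dense sets are bounded by pairs [c i], and an [N] covering the union of the meager
    sets of all [c i] gives a suitable family. *)
Lemma star_omega_cofinal_of_cofinal_meager (M : set (set cantor_space)) :
  cofinal_in (@meager cantor_space) M ->
  exists2 F, star_omega_cofinal nwd F & F #<= M.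
Proof.
move=> [MI Mcof].
have /choice[b bP] : forall N : set cantor_space, exists b : (nat -> nat) * (nat -> bool),
    increasing b.1 /\ (M N -> N `<=` block_meager b.1 b.2).
  move=> N; have [/MI/meager_blocks[a [z [a_inc Naz]]]|nN] := pselect (M N).
    by exists (a, z).
  by exists (id, xpredT); split=> [k|//]; rewrite /= ltnSn.
exists ((fun N => range (block_nwd (b N).1 (b N).2)) @` M); last exact: card_image_le.
split=> [_ [N MN <-]|Bs [BsI /denumerable_range[e Bse]]].
  have [b_inc _] := bP N.
  split; first by move=> _ [k _ <-]; exact: block_nwd_nwd.
  apply: inj_card_eq => k l _ _ kl; apply/eqP; rewrite eqn_leq.
  have lek i j : block_nwd (b N).1 (b N).2 i = block_nwd (b N).1 (b N).2 j -> (j <= i)%N.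
    move=> ij; rewrite leqNgt; apply/negP => ltij.
    (* This node agrees with the real on block [i] but is too short to cover block [j]: the sets are
       distinct and the family is infinite. *)
    have : block_nwd (b N).1 (b N).2 j (mkseq (b N).2 ((b N).1 i.+1)).
      move=> k' jk'; rewrite size_mkseq leqNgt.
      by rewrite (leq_ltn_trans (increasing_leq b_inc (leq_trans ltij jk')))// b_inc.
    rewrite -ij => /(_ i (leqnn i)); rewrite size_mkseq leqnn => /(_ isT); apply.
    by move=> m /andP[_ mi]; rewrite nth_mkseq.
  by rewrite !lek.
have /choice[c cP] : forall i, exists c : (nat -> nat) * (nat -> bool),
    increasing c.1 /\ e i `<=` block_nwd c.1 c.2 0.
  move=> i; have [_|a [z [a_inc az]]] := @nwd_blocks (fun=> e i).
    by apply: BsI; rewrite Bse; exists i.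
  by exists (a, z); split=> //; exact: (az 0).
have [|N MN sub] := Mcof (\bigcup_i block_meager (c i).1 (c i).2).
  by apply: meager_bigcup => i; apply: block_meager_meager; have [] := cP i.
exists (range (block_nwd (b N).1 (b N).2)); first by exists N.
have [b_inc /(_ MN) Nb] := bP N.
rewrite Bse => _ [i _ <-]; have [c_inc eic] := cP i.
have [|k0 _ k0P] := @block_meager_sub (c i).1 (b N).1 (c i).2 (b N).2 c_inc b_inc.
  by apply: subset_trans Nb; apply: subset_trans sub => x xc; exists i.
exists (block_nwd (b N).1 (b N).2 k0); first by exists k0.
rewrite /subset_mod_fin (_ : _ `\` _ = set0) //.
apply/seteqP; split=> // u [/eic uc]; apply => k kk0 ku ub.
have [l [kl lk yz]] := k0P k kk0; apply: (uc l) => //; first exact: leq_trans ku.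
move=> j /[dup] /andP[lj jl] /yz <-; apply: ub.
by rewrite (leq_trans kl lj) (leq_trans jl lk).
Qed.

(** A family is sent to the union of the sets of branches eventually inside its members. It is
    tested on the trees of the nowhere dense sets covering a given meager set. *)
Lemma cofinal_meager_of_star_omega_cofinal (F : set (set (set (seq bool)))) :
  star_omega_cofinal nwd F ->
  exists2 M, cofinal_in (@meager cantor_space) M & M #<= F.
Proof.
move=> [FI Fcof].
pose lim (A : set (seq bool)) : set cantor_space :=
  [set x | \forall n \near \oo, A (mkseq x n)].
have lim_meager A : nwd A -> meager (lim A).
  move=> Anwd.
  exists (fun m => [set x : cantor_space | forall n, (m <= n)%N -> A (mkseq x n)]).
    move=> m; apply/nowhere_dense_nwdP => s.
    (* [s] is first lengthened by [m] bits, since restrictions of points of the set must lie in [A]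
       from length [m] on. *)
    have [t st tA] := Anwd (s ++ nseq m false).
    exists t => [|u tu [x [xu xm]]]; first exact: catl_prefix st.
    apply: (tA u tu); rewrite -xu; apply: xm.
    apply: leq_trans (size_prefix tu); apply: leq_trans (size_prefix st).
    by rewrite size_cat size_nseq leq_addl.
  by move=> x [m _ mx]; exists m.
exists ((fun As => \bigcup_(A in As) lim A) @` F); last exact: card_image_le.
split=> [_ [As FAs <-]|N [G Gnd NG]].
  have [AsI /denumerable_range[e Ase]] := FI _ FAs.
  apply: (@meager_sub _ _ (\bigcup_n lim (e n))).
    by rewrite [X in \bigcup_(A in X) _]Ase bigcup_image.
  by apply: meager_bigcup => n; apply/lim_meager/AsI; rewrite Ase; exists n.
pose T n := [set s | cylinder s `&` G n !=set0].
have [|As FAs AsP] := Fcof (range T `|` range set1).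
  apply: omega_subsets_extend.
  - exact: countableP.
  - exact: infinite_seq_bool.
  - exact: nwd_set1.
  - exact: card_image_le.
  - by move=> _ [n _ <-]; exact/nowhere_dense_nwdP.
exists (\bigcup_(A in As) lim A); first by exists As.
move=> x /NG[n _ Gx].
have [|A AsA TA] := AsP (T n); first by left; exists n.
exists A => //; have /finite_nat_bound[m mP] := finite_image size TA.
exists m.+1 => // k /= mk; apply: contrapT => nA.
have : (k <= m)%N.
  apply: mP; exists (mkseq x k); last by rewrite size_mkseq.
  by split=> //; exists x; split=> //; exact: cylinder_mkseq.
by rewrite leqNgt mk.
Qed.

Lemma cof_star_omega_nwd : exists K : set (set cantor_space),
  cof (@meager cantor_space) K /\ cof_star_omega nwd K.
Proof.
apply: min_card_transfer.
- exists (@meager cantor_space); split=> // B Bm.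
  by exists B.
- exact: star_omega_cofinal_of_cofinal_meager.
- exact: cofinal_meager_of_star_omega_cofinal.
Qed.

(** * ED, its restriction and the linear growth ideal *)

Lemma near_all_lt (P : nat -> nat -> Prop) (k : nat) :
  (forall i, (i < k)%N -> \forall n \near \oo, P i n) ->
  \forall n \near \oo, forall i, (i < k)%N -> P i n.
Proof.
elim: k => [_|k IHk kP]; first by exists 0.
have [N _ NP] := IHk (fun i ik => kP i (ltnW ik)).
have [M _ MP] := kP k (ltnSn k).
exists (maxn N M) => // n /=; rewrite geq_max => /andP[Nn Mn] i.
by rewrite ltnS leq_eqVlt => /predU1P[->|]; [exact: MP | exact: NP].
Qed.

Lemma subset_mod_fin_range (X : Type) (u : nat -> X) (A : set X) :
  injective u -> subset_mod_fin (range u) A -> \forall n \near \oo, A (u n).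
Proof.
move=> u_inj uA.
have /finite_nat_bound[M MP] : finite_set [set n | ~ A (u n)].
  apply: card_le_finite uA; apply: (@card_le_inj _ _ _ _ u) => [n nA|m n _ _].
    by split=> //; exists n.
  exact: u_inj.
exists M.+1 => // n /= Mn; apply: contrapT => /MP.
by rewrite leqNgt Mn.
Qed.

(** * Codes of the finite restrictions of branches *)

Definition code (x : nat -> bool) (h : nat) : nat :=
  enum_rank [tuple x i | i < h].

Lemma code_lt (x : nat -> bool) (h : nat) : (code x h < 2 ^ h)%N.
Proof.
rewrite (_ : 2 ^ h = #|{:h.-tuple bool}|)%N; first exact: ltn_ord.
by rewrite card_tuple card_bool.
Qed.

Lemma code_inj (x y : nat -> bool) (h i : nat) :
  (i < h)%N -> code x h = code y h -> x i = y i.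
Proof.
move=> ih /val_inj/enum_rank_inj/(congr1 (fun t => tnth t (Ordinal ih))).
by rewrite !tnth_mktuple.
Qed.

Lemma code_neq (h : nat -> nat) (x y : nat -> bool) :
  (forall i, \forall n \near \oo, (i < h n)%N) -> x <> y ->
  \forall n \near \oo, code x (h n) <> code y (h n).
Proof.
move=> h_oo xy; have [i xyi] : exists i, x i <> y i.
  apply: contrapT => nex; apply: xy; apply/funext => i.
  by apply: contrapT => xyi; apply: nex; exists i.
have [N _ NP] := h_oo i; exists N => // n /NP /= ih.
by move=> /(code_inj ih).
Qed.

(** Distinct branches have distinct codes once [h n] exceeds a place where they differ; [k] branches
    form finitely many pairs, so one threshold suits them all. *)
Lemma infinite_branches (h : nat -> nat) (S : set (nat -> bool))
    (P : (nat -> bool) -> nat -> Prop) (k : nat) :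
  (forall i, \forall n \near \oo, (i < h n)%N) ->
  (forall x, S x -> \forall n \near \oo, P x n) -> infinite_set S ->
  exists e : nat -> nat -> bool, \forall n \near \oo, forall i, (i < k)%N ->
    P (e i) n /\
    forall j, (j < k)%N -> code (e i) (h n) = code (e j) (h n) -> i = j.
Proof.
move=> h_oo SP /infiniteP/pcard_leP[e]; exists e.
have Se i : S (e i) by exact: funS.
apply: near_all_lt => i ik.
have [N _ NP] := SP _ (Se i).
have [M _ MP] : \forall n \near \oo, forall j, (j < k)%N ->
    code (e i) (h n) = code (e j) (h n) -> i = j.
  apply: near_all_lt => j jk; have [->|ij] := eqVneq i j; first by exists 0.
  have [|M _ MP] := @code_neq h (e i) (e j) h_oo.
    by move=> eij; move/eqP: ij; apply; apply: (@inj _ _ _ e); rewrite ?inE.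
  by exists M => // n /MP.
exists (maxn N M) => // n /=; rewrite geq_max => /andP[Nn Mn].
by split; [exact: NP | exact: MP].
Qed.

Lemma ED_graph (A : set (nat * nat)) (g : nat -> nat) :
  A `<=` [set p | p.2 = g p.1] -> ED A.
Proof.
move=> Ag; exists 1; exists 0 => // n _.
have /card_eqPle[+ _] := @card_set1 _ (g n); apply: card_le_trans.
by apply: subset_card_le => m /Ag.
Qed.

Lemma ED_set1 (p : nat * nat) : ED [set p].
Proof. by apply: (@ED_graph _ (fun=> p.2)) => _ ->. Qed.

(** Otherwise [k.+1] branches would put [k.+1] distinct points of [A] in a column that has at most
    [k]. *)
Lemma ED_finite_branches (h : nat -> nat) (S : set (nat -> bool))
    (A : set (nat * nat)) :
  (forall i, \forall n \near \oo, (i < h n)%N) -> ED A ->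
  (forall x, S x -> \forall n \near \oo, A (n, code x (h n))) -> finite_set S.
Proof.
move=> h_oo [k [N _ NA]] SA; apply: contrapT.
move=> /(infinite_branches k.+1 h_oo SA)[e [M _ Me]].
have NM : [set n | (N <= n)%N] (maxn N M) by rewrite /= leq_maxl.
have /Me Mk : (M <= maxn N M)%N by rewrite leq_maxr.
suff : (`I_k.+1 #<= `I_k)%card by rewrite card_le_II ltnn.
apply: card_le_trans (NA _ NM).
apply: (@card_le_inj _ _ _ _ (fun i => code (e i) (h (maxn N M)))) => [i ik|i j ik jk].
  by have [] := Mk i ik.
by have [_] := Mk i ik; apply.
Qed.

Lemma cof_star_omega_ED : cof_star_omega ED continuum.
Proof.
pose u x n := (n, code x n).
have u_inj x : injective (u x) by move=> m n [].
apply: (@cof_star_omega_continuum _ _ (fun x => range (u x))).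
- exact: countableP.
- exact: infinite_prod_nat.
- exact: ED_set1.
- by move=> x; apply: (@ED_graph _ (code x)) => _ [n _ <-].
move=> A EDA; apply: (@ED_finite_branches id _ A) => // x xA.
exact: (subset_mod_fin_range (u_inj x) xA).
Qed.

Lemma cof_star_omega_ED_fin : cof_star_omega ED_fin continuum.
Proof.
pose D := [set p : nat * nat | (p.2 <= p.1)%N].
(* Then [2 ^ h n <= n] for positive [n], so the codes stay below the diagonal; in column 0 the only
   code is 0. *)
pose h n := trunc_log 2 n.
have codeD x n : D (n, code x (h n)).
  case: n => [|n]; first by have := code_lt x (h 0); rewrite /h trunc_log0 expn0 ltnS.
  apply: ltnW; apply: leq_trans (code_lt x _) _.
  exact: trunc_logP.
pose u x n : D := SigSub (mem_set (codeD x n)).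
have u_inj x : injective (u x).
  by move=> m n /(congr1 (fun p : D => (val p).1)).
apply: (@cof_star_omega_continuum _ _ (fun x => range (u x))).
- apply: (@sub_countable _ _ _ D) (countableP D).
  by have /card_eqPle[] := card_setT D.
- apply/infiniteP; apply: (@card_le_inj _ _ _ _ (u xpredT)) => // m n _ _.
  exact: u_inj.
- by move=> p; rewrite /ED_fin/restrict_ideal/= image_set1; exact: ED_set1.
- move=> x; apply: (@ED_graph _ (fun n => code x (h n))).
  by move=> _ [_ [n _ <-] <-].
move=> A EDA; apply: (@ED_finite_branches h _ _ _ EDA) => // [i|x xA].
  exists (2 ^ i.+1)%N => // n /= ni; exact: trunc_log_max.
have [N _ NP] := subset_mod_fin_range (u_inj x) xA.
by exists N => // n /NP Au; exists (u x n).
Qed.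

(** * The linear growth ideal *)

Lemma block_inj (i j n : nat) : block i n -> block j n -> i = j.
Proof.
rewrite /block /= => /andP[i1 i2] /andP[j1 j2].
have ltS k l : (2 ^ k - 1 <= n)%N -> (n < 2 ^ l.+1 - 1)%N -> (k <= l)%N.
  move=> kn nl; rewrite -ltnS -(ltn_exp2l _ _ (ltnSn 1)).
  have := leq_ltn_trans kn nl; rewrite !subn1 -ltnS !prednK ?expn_gt0//.
apply/eqP; rewrite eqn_leq; apply/andP; split; exact: ltS.
Qed.

(** As [i] is the sum of [i./2] and [uphalf i], this makes [2 ^ i./2] pieces of length [i] fit in a
    block of size [2 ^ i]. *)
Lemma leq_exp2_uphalf (i : nat) : (i <= 2 ^ uphalf i)%N.
Proof.
have dbl n : (n.+1.*2 <= 2 ^ n.+1)%N.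
  elim: n => // n IHn; rewrite expnS mul2n leq_double; apply: leq_trans IHn.
  by rewrite -addnn addSn ltnS leq_addl.
case: i => // i; rewrite uphalfE /=; apply: leq_trans (dbl i./2).
by rewrite doubleS ltnS -[X in (X <= _)%N]odd_double_half; case: (odd _).
Qed.

(* The [c]-th of the consecutive pieces of length [i] of [block i]. *)
Definition piece (i c j : nat) : nat := (2 ^ i - 1 + (c * i + j))%N.

Lemma piece_block (i c j : nat) : (c < 2 ^ i./2)%N -> (j < i)%N ->
  block i (piece i c j).
Proof.
move=> c_lt ji; rewrite /block /piece /= leq_addr /=.
have ci : (c * i + j < 2 ^ i)%N.
  apply: (@leq_trans (2 ^ i./2 * i)).
    apply: (@leq_trans (c.+1 * i)); first by rewrite mulSn addnC ltn_add2r.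
    by rewrite leq_mul2r c_lt orbT.
  by rewrite -[X in (_ <= 2 ^ X)%N]odd_double_half -addnn addnA -uphalf_half
    addnC expnD leq_mul2l leq_exp2_uphalf orbT.
by rewrite expnS mul2n -addnn -addnBAC ?expn_gt0// ltn_add2l.
Qed.

Lemma piece_inj (i c c' j j' : nat) : (j < i)%N -> (j' < i)%N ->
  piece i c j = piece i c' j' -> c = c' /\ j = j'.
Proof.
move=> ji j'i /addnI e; have i_gt0 : (0 < i)%N by exact: leq_ltn_trans ji.
split.
  have := congr1 (divn^~ i) e.
  by rewrite !divnMDl// !divn_small// !addn0.
by have := congr1 (modn^~ i) e; rewrite !modnMDl !modn_small.
Qed.

Lemma linear_ideal_pieces (A : set nat) (c : nat -> nat) :
  (forall i, (c i < 2 ^ i./2)%N) ->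
  A `<=` [set n | exists i j, (j < i)%N /\ n = piece i (c i) j] ->
  linear_ideal A.
Proof.
move=> c_lt Ac; exists 1; exists 0 => // i _; rewrite mul1n.
apply: (@card_le_trans _ _ _ (piece i (c i) @` `I_i)); last exact: card_image_le.
apply: subset_card_le => n [/Ac[i' [j [ji' nE]]] iN].
have ii' : i = i'.
  by apply: (block_inj iN); rewrite nE; exact: piece_block.
by exists j; rewrite ?nE ii'.
Qed.

Lemma cof_star_omega_linear_ideal : cof_star_omega linear_ideal continuum.
Proof.
(* The bound on block [i] is a multiple of [i], so each branch takes [i] points there: [k.+1]
   branches then exceed [k * i]. *)
pose B x := [set n | exists i j, (j < i)%N /\ n = piece i (code x i./2) j].
have half_oo i : \forall n \near \oo, (i < n./2)%N.
  exists i.+1.*2 => // n /= /half_leq; by rewrite doubleK.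
apply: (@cof_star_omega_continuum _ _ B).
- exact: countableP.
- exact: infinite_nat.
(* Block 0 is skipped, its bound [k * 0] being 0. *)
- move=> n; exists 1; exists 1 => // i /= i_gt0; rewrite mul1n.
  apply: (@card_le_trans _ _ _ `I_1); last by rewrite card_le_II.
  have /card_eqPle[+ _] := @card_set1 _ n; apply: card_le_trans.
  by apply: subset_card_le => m [].
- by move=> x; apply: (@linear_ideal_pieces _ (fun i => code x i./2)) => // i;
    exact: code_lt.
move=> A [k [N _ NA]]; apply: contrapT.
pose P x i := forall j, (j < i)%N -> A (piece i (code x i./2) j).
have SP x : subset_mod_fin (B x) A -> \forall i \near \oo, P x i.
  move=> /finite_nat_bound[M MP]; exists M.+2 => // i /= Mi j ji.
  apply: contrapT => nA.
  have : (piece i (code x i./2) j <= M)%N by apply: MP; split=> //; exists i, j.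
  rewrite leqNgt /piece; apply/negP; rewrite negbK.
  apply: leq_trans (leq_addr _ _); rewrite ltn_subRL add1n.
  by apply: leq_trans Mi _; rewrite ltnW// ltn_expl.
move=> /(infinite_branches k.+1 half_oo SP)[e [M _ Me]].
pose i := maxn N M.+1.
have /Me Mk : (M <= i)%N by rewrite /i leq_max leqnSn orbT.
have i_gt0 : (0 < i)%N by rewrite /i leq_max ltn0Sn orbT.
have Ni : [set n | (N <= n)%N] i by rewrite /= leq_maxl.
suff : (`I_(k.+1 * i) #<= `I_(k * i))%card.
  by rewrite card_le_II leq_mul2r ltnn orbF => /eqP i0; rewrite i0 in i_gt0.
apply: card_le_trans (NA _ Ni).
have quo t : (t < k.+1 * i)%N -> (t %/ i < k.+1)%N by rewrite ltn_divLR.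
apply: (@card_le_inj _ _ _ _
    (fun t => piece i (code (e (t %/ i)%N) i./2) (t %% i)%N)) => [t tk|s t sk tk].
  have [PA _] := Mk _ (quo _ tk); split; first by apply: PA; rewrite ltn_mod.
  by apply: piece_block; [exact: code_lt | rewrite ltn_mod].
move=> /piece_inj[||st mst]; rewrite ?ltn_mod//.
have [_ /(_ _ (quo _ tk) st) dst] := Mk _ (quo _ sk).
by rewrite (divn_eq s i) (divn_eq t i) dst mst.
Qed.

(** * The ideal conv *)

Lemma generated_ideal_ideal (X : Type) (G : set (set X)) :
  ideal (generated_ideal G).
Proof.
split=> [A Afin J [[Jfin _ _] _]|A B AB GB J JG|A B GA GB J JG]; first exact: Jfin.
  by have [[_ Jsub _] _] := JG; apply: Jsub AB _; exact: GB.
by have [[_ _ JU] _] := JG; apply: JU; [exact: GA | exact: GB].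
Qed.

Lemma generated_ideal_set1 (X : Type) (G : set (set X)) (x : X) :
  generated_ideal G [set x].
Proof. by have [+ _ _] := generated_ideal_ideal G; apply. Qed.

(* The digits are 1 and 2, so that the sequence is strictly increasing. *)
Definition quaternary (x : nat -> bool) (n : nat) : rat :=
  \sum_(i < n) (1 + (x i)%:R) * 4^-1 ^+ i.+1.

Lemma quaternaryS (x : nat -> bool) (n : nat) :
  quaternary x n.+1 = quaternary x n + (1 + (x n)%:R) * 4^-1 ^+ n.+1.
Proof. by rewrite /quaternary big_ord_recr. Qed.

Lemma quaternary_ltS (x : nat -> bool) (n : nat) :
  quaternary x n < quaternary x n.+1.
Proof.
rewrite quaternaryS ltrDl mulr_gt0// ?exprn_gt0//.
Qed.

Lemma quaternary_le (x : nat -> bool) : {homo quaternary x : m n / (m <= n)%N >-> m <= n}.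
Proof. by apply: (homo_leq (@lexx _ _) le_trans) => n; exact/ltW/quaternary_ltS. Qed.

Lemma quaternary_inj (x : nat -> bool) : injective (quaternary x).
Proof.
have lt m n : (m < n)%N -> quaternary x m < quaternary x n.
  by move=> mn; apply: lt_le_trans (quaternary_ltS x m) _; exact: quaternary_le.
move=> m n e; have [/lt|/lt|//] := ltngtP m n; by rewrite e ltxx.
Qed.

(** The added term is the sum of the series with all digits 2 from [k] on. *)
Lemma quaternary_tail (x : nat -> bool) (k n : nat) : (k <= n)%N ->
  quaternary x n <= quaternary x k + 2 / 3 * 4^-1 ^+ k.
Proof.
move=> /subnKC <-; move: (n - k)%N => {n} m.
suff : quaternary x (k + m) <=
    quaternary x k + 2 / 3 * 4^-1 ^+ k - 2 / 3 * 4^-1 ^+ (k + m).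
  have : (0 : rat) <= 4^-1 ^+ (k + m) by apply: exprn_ge0.
  lra.
elim: m => [|m IHm]; first by rewrite addn0; lra.
rewrite addnS quaternaryS exprS.
have : (0 : rat) <= 4^-1 ^+ (k + m) by apply: exprn_ge0.
by case: (x _) => /=; lra.
Qed.

Lemma quaternary01 (x : nat -> bool) (n : nat) : rat01 (quaternary x n).
Proof.
have := quaternary_le x (leq0n n); have := quaternary_tail x (leq0n n).
by rewrite /rat01 /= /quaternary big_ord0 expr0 => h1 h2; apply/andP; split; lra.
Qed.

Section quaternary_limit.
Variable R : realType.

Definition quaternary_lim (x : nat -> bool) : R :=
  sup (range (fun n => ratr (quaternary x n))).

Lemma quaternary_cvg (x : nat -> bool) :
  (fun n => ratr (quaternary x n) : R) @ \oo --> quaternary_lim x.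
Proof.
apply: nondecreasing_cvgn; first by move=> m n mn; rewrite ler_rat quaternary_le.
exists 1 => _ [n _ <-]; have /andP[_ n1] := quaternary01 x n.
by rewrite -(rmorph1 (@ratr R)) ler_rat.
Qed.

Lemma quaternary_lim_ge (x : nat -> bool) (n : nat) :
  ratr (quaternary x n) <= quaternary_lim x.
Proof.
apply: cvgr_to_ge (@quaternary_cvg x) _.
by exists n => // m /= nm; rewrite ler_rat quaternary_le.
Qed.

Lemma quaternary_lim_le (x : nat -> bool) (n : nat) :
  quaternary_lim x <= ratr (quaternary x n + 2 / 3 * 4^-1 ^+ n).
Proof.
apply: cvgr_to_le (@quaternary_cvg x) _.
by exists n => // m /= nm; rewrite ler_rat quaternary_tail.
Qed.

Lemma quaternary_lim_inj : injective quaternary_lim.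
Proof.
move=> x y; apply: contraPP => xy.
have [|k xyk kmin] := @ex_minnP (fun i => x i != y i).
  apply: contrapT => nex; apply: xy; apply/funext => i.
  by apply/eqP/negPn/negP => xyi; apply: nex; exists i.
have {}kmin i : (i < k)%N -> x i = y i.
  by move=> ik; apply/eqP; case: eqVneq => // /kmin; rewrite leqNgt ik.
have xyk' : quaternary x k = quaternary y k.
  by apply: eq_bigr => i _; rewrite kmin.
(* At the first difference, a digit 1 followed by the largest tail stays below a digit 2, as
   [2 / 3 < 1]. *)
have key (u v : nat -> bool) : quaternary u k = quaternary v k -> u k = false ->
    v k = true -> quaternary_lim u < quaternary_lim v.
  move=> uvk uk vk; apply: le_lt_trans (quaternary_lim_le u k.+1) _.
  apply: lt_le_trans (quaternary_lim_ge v k.+1).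
  rewrite ltr_rat !quaternaryS uvk uk vk /=.
  have : (0 : rat) < 4^-1 ^+ k.+1 by apply: exprn_gt0.
  lra.
move: xyk; case xk: (x k); case yk: (y k) => // _ xylim.
  by have := key y x (esym xyk') yk xk; rewrite xylim ltxx.
by have := key x y xyk' xk yk; rewrite xylim ltxx.
Qed.

(** All accumulation points of [A] lie in the finite list [s]. These sets form an ideal containing
    the convergent sequences, hence [conv_ideal]. *)
Definition finitely_accumulating (A : set rat01) :=
  exists s : seq R, forall e, 0 < e -> finite_set
    [set a | A a /\ forall t, t \in s -> e <= `|ratr (set_val a) - t|].

Lemma finitely_accumulating_ideal : ideal finitely_accumulating.
Proof.
split=> [A Afin|A B AB [s sP]|A B [s sP] [t tP]].
- by exists [::] => e _; apply: sub_finite_set Afin => a [].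
- by exists s => e /sP; apply: sub_finite_set => a [/AB].
exists (s ++ t) => e e0.
apply: (@sub_finite_set _ _ (_ `|` _)); last first.
  by rewrite finite_setU; split; [exact: sP e e0 | exact: tP e e0].
move=> a [[Aa|Ba] st]; [left|right]; split=> // r rs; apply: st;
  by rewrite mem_cat rs ?orbT.
Qed.

Lemma seq_distance (s : seq R) (l : R) : l \notin s ->
  exists2 e, 0 < e & forall t, t \in s -> e <= `|l - t|.
Proof.
elim: s => [|t s IHs]; first by exists 1.
rewrite inE negb_or => /andP[lt /IHs[e e0 es]].
exists (Num.min e `|l - t|); first by rewrite lt_min e0 normr_gt0 subr_eq0.
move=> r; rewrite inE => /predU1P[->|/es er]; first by rewrite ge_min lexx orbT.
by rewrite ge_min er.
Qed.

Lemma conv_finitely_accumulating : @conv_ideal R `<=` finitely_accumulating.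
Proof.
apply: smallest_sub; first exact: finitely_accumulating_ideal.
move=> _ [x -> [l _ xl]]; exists [:: l] => e e0.
have /cvgrPdist_lt/(_ e e0)[N _ NP] := xl.
apply: (@sub_finite_set _ _ (x @` `I_N)); last exact/finite_image.
move=> _ [[n _ <-]] /(_ l); rewrite inE eqxx => /(_ isT) el.
exists n => //=; rewrite ltnNge; apply/negP => /NP /=.
by rewrite distrC ltNge el.
Qed.

Lemma cof_star_omega_conv : cof_star_omega (@conv_ideal R) continuum.
Proof.
pose u x n : rat01 := SigSub (mem_set (quaternary01 x n)).
have u_inj x : injective (u x).
  by move=> m n /(congr1 val) /=; exact: quaternary_inj.
apply: (@cof_star_omega_continuum _ _ (fun x => range (u x))).
- apply: (@sub_countable _ _ _ rat01) (countableP rat01).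
  by have /card_eqPle[] := card_setT rat01.
- apply/infiniteP; apply: (@card_le_inj _ _ _ _ (u xpredT)) => // m n _ _.
  exact: u_inj.
- exact: generated_ideal_set1.
- move=> x; apply: sub_gen_smallest; exists (u x) => //.
  exists (quaternary_lim x); last exact: quaternary_cvg.
  have /andP[n0 _] := quaternary01 x 0; apply/andP; split.
    apply: le_trans (quaternary_lim_ge x 0).
    by rewrite -(rmorph0 (@ratr R)) ler_rat.
  apply: le_trans (quaternary_lim_le x 0) _.
  rewrite -(rmorph1 (@ratr R)) ler_rat /quaternary big_ord0 expr0; lra.
move=> A /conv_finitely_accumulating[s sP].
apply: (@card_le_finite _ _ _ [set` s]) => //.
apply: (@card_le_inj _ _ _ _ quaternary_lim) => [x /= xA|x y _ _]; last first.
  exact: quaternary_lim_inj.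
(* If the limit is at distance at least [e] from [s], infinitely many terms in [A] are at distance
   at least [e / 2], which [sP] forbids. *)
apply: contrapT => /negP /seq_distance[e e0 es].
have [N _ NA] := subset_mod_fin_range (u_inj x) xA.
have /cvgrPdist_lt/(_ (e / 2))[|M _ MP] := @quaternary_cvg x.
  by rewrite divr_gt0.
have : infinite_set [set n | (maxn N M <= n)%N].
  move=> /finite_nat_bound[K KP].
  have := KP (maxn (maxn N M) K.+1); rewrite /= leq_maxl => /(_ isT).
  by rewrite leqNgt leq_max ltnSn orbT.
apply; apply: card_le_finite (sP (e / 2) _); last by rewrite divr_gt0.
apply: (@card_le_inj _ _ _ _ (u x)) => [n /=|m n _ _]; last exact: u_inj.
rewrite geq_max => /andP[Nn Mn]; split; first exact: NA.
move=> t /es et; have /= := MP n Mn.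
have : `|quaternary_lim x - t| <= `|quaternary_lim x - ratr (quaternary x n)|
    + `|ratr (quaternary x n) - t| by exact: ler_distD.
move: et; rewrite -[ratr (set_val _)]/(ratr (quaternary x n)).
move: `|_ - ratr _| `|ratr _ - _| `|_ - t| => a b c; lra.
Qed.

End quaternary_limit.

(** * The random graph ideal *)

Lemma rado_extension (E : rel nat) (g : nat -> bool) (l : seq nat) :
  rado_graph E -> uniq l ->
  exists m, m \notin l /\ forall i, (i < size l)%N -> E m (nth 0 l i) = g i.
Proof.
move=> [_ _ Eext] l_uniq.
pose S b := [set m | exists i, [/\ (i < size l)%N, g i = b & m = nth 0 l i]].
have Sfin b : finite_set (S b).
  apply: sub_finite_set (finite_seq l) => _ [i [il _ ->]] /=.
  exact: mem_nth.
have [|m [m1 m0 mE mnE]] := Eext (S true) (S false) (Sfin _) (Sfin _).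
  apply/seteqP; split=> // _ [[i [il gi ->]] [j [jl gj /eqP]]].
  by rewrite nth_uniq// => /eqP ij; rewrite ij gj in gi.
exists m; split=> [|i il].
  apply/negP => ml; move: (ml); rewrite -index_mem => il.
  case gi: (g (index m l)).
    by apply: m1; exists (index m l); rewrite nth_index.
  by apply: m0; exists (index m l); rewrite nth_index.
case gi: (g i); first by apply: mE; exists i.
by apply/negbTE/mnE; exists i.
Qed.

(** Universality of Rado's graph: vertices are chosen one at a time by the extension property,
    [next l] being joined to the members of [l] as [G] prescribes. *)
Lemma rado_embed (E G : rel nat) : rado_graph E -> symmetric G ->
  exists2 f : nat -> nat, injective f &
    forall i j, i <> j -> E (f i) (f j) = G i j.
Proof.
move=> Erado Gsym.
have /choice[next nextP] : forall l : seq nat, exists m, uniq l -> m \notin l /\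
    forall i, (i < size l)%N -> E m (nth 0 l i) = G (size l) i.
  move=> l; have [l_uniq|] := boolP (uniq l); last by exists 0.
  by have [m] := rado_extension (G (size l)) Erado l_uniq; exists m.
pose fix st k := if k is k'.+1 then rcons (st k') (next (st k')) else [::].
have st_size k : size (st k) = k by elim: k => //= k IHk; rewrite size_rcons IHk.
have st_uniq k : uniq (st k).
  by elim: k => //= k IHk; rewrite rcons_uniq IHk; have [-> _] := nextP _ IHk.
pose f k := next (st k).
have st_nth k i : (i < k)%N -> nth 0 (st k) i = f i.
  elim: k => // k IHk; rewrite ltnS leq_eqVlt /= nth_rcons st_size => /predU1P[->|ik].
    by rewrite ltnn eqxx.
  by rewrite ik IHk.
have f_lt i j : (i < j)%N -> f j <> f i /\ E (f j) (f i) = G j i.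
  move=> ij; have [fj jP] := nextP _ (st_uniq j).
  rewrite -(st_nth j i)//; split; last by rewrite jP ?st_size.
  by move=> fji; move: fj; rewrite -/(f j) fji mem_nth ?st_size.
have [_ Esym _] := Erado.
exists f => [i j fij|i j /eqP].
  by have [/f_lt[]|/f_lt[]|//] := ltngtP i j; rewrite fij.
by rewrite neq_ltn => /orP[/f_lt[_]|/f_lt[_ ->//]]; rewrite Esym Gsym.
Qed.

Definition comparable_nodes (s t : seq bool) : bool := prefix s t || prefix t s.

Lemma comparable_mkseq (x y : nat -> bool) (m n i : nat) :
  comparable_nodes (mkseq x m) (mkseq y n) -> (i < m)%N -> (i < n)%N ->
  x i = y i.
Proof.
have cmp (u v : nat -> bool) k l : prefix (mkseq u k) (mkseq v l) -> (i < k)%N -> (i < l)%N ->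
    u i = v i.
  rewrite prefixE size_mkseq => /eqP kl ik il.
  by rewrite -(nth_mkseq false u ik) -kl nth_take// nth_mkseq.
move=> /orP[xy|yx] im i_n; first exact: cmp xy im i_n.
by apply/esym; exact: cmp yx i_n im.
Qed.

Definition covered_by_homogeneous (E : rel nat) (A : set nat) : Prop :=
  exists (n : nat) (H : nat -> set nat),
    (forall i, (i < n)%N -> clique E (H i) \/ independent E (H i)) /\
    A `<=` [set a | exists2 i, (i < n)%N & H i a].

Lemma covered_by_homogeneous_ideal (E : rel nat) :
  ideal (covered_by_homogeneous E).
Proof.
split=> [A /finite_seqP[s ->]|A B AB [n [H [Hhom BH]]]|A B].
- exists (size s), (fun i => [set nth 0 s i]); split=> [i _|a /= sa].
    by left => x y -> ->.
  by exists (index a s); rewrite ?index_mem ?nth_index.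
- by exists n, H; split=> //; exact: subset_trans BH.
move=> [n [H [Hhom AH]]] [m [K [Khom BK]]].
exists (n + m)%N, (fun i => if (i < n)%N then H i else K (i - n)%N); split=> [i inm|a].
  case: ltnP => [|ni]; first exact: Hhom.
  by apply: Khom; rewrite ltn_subLR.
move=> [/AH[i i_n Ha]|/BK[j jm Ka]].
  by exists i; rewrite ?i_n ?(leq_trans i_n) ?leq_addr.
by exists (n + j)%N; rewrite ?ltn_add2l// ltnNge leq_addr/= addKn.
Qed.

(* The branches of a copy of the comparability graph of the binary tree are
   cliques, and no homogeneous set has infinite intersections with two of
   them. *)
Lemma cof_star_omega_random_graph (E : rel nat) : rado_graph E ->
  cof_star_omega (random_graph_ideal E) continuum.
Proof.
move=> Erado; pose G i j := if (unpickle i, unpickle j) is (Some s, Some t)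
  then comparable_nodes s t else false.
have Gsym : symmetric G.
  move=> i j; rewrite /G; case: unpickle => [s|]; case: unpickle => [t|] //.
  by rewrite /comparable_nodes orbC.
have [f f_inj fG] := rado_embed Erado Gsym.
pose e (s : seq bool) := f (pickle s).
have e_inj : injective e by move=> s t /f_inj/(pcan_inj pickleK).
have eE s t : s <> t -> E (e s) (e t) = comparable_nodes s t.
  move=> st; rewrite fG ?/G ?pickleK//.
  by move=> /(pcan_inj pickleK).
pose u x n := e (mkseq x n).
have u_inj x : injective (u x).
  by move=> m n /e_inj/(congr1 size); rewrite !size_mkseq.
have u_clique x : clique E (range (u x)).
  move=> _ _ [m _ <-] [n _ <-] umn; rewrite eE; last by move=> mn; apply: umn; rewrite /u mn.
  have [mn|/ltnW nm] := leqP m n; apply/orP; [left|right]; exact: mkseq_prefix.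
apply: (@cof_star_omega_continuum _ _ (fun x => range (u x))).
- exact: countableP.
- exact: infinite_nat.
- exact: generated_ideal_set1.
- by move=> x; apply: sub_gen_smallest; left; exact: u_clique.
have sub : random_graph_ideal E `<=` covered_by_homogeneous E.
  apply: smallest_sub; first exact: covered_by_homogeneous_ideal.
  by move=> H Hhom; exists 1, (fun=> H); split=> // a Ha; exists 0.
move=> A /sub[n [H [Hhom AH]]].
(* By pigeonhole, a branch almost contained in [A] meets one of the finitely many homogeneous sets
   infinitely often. *)
have branch x : subset_mod_fin (range (u x)) A -> exists i, (i < n)%N /\
    forall m, exists2 k, (m <= k)%N & H i (u x k).
  move=> /(subset_mod_fin_range (u_inj x))[N _ NA]; apply: contrapT => nex.
  have [M _ MP] : \forall k \near \oo, forall i, (i < n)%N -> ~ H i (u x k).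
    apply: near_all_lt => i i_n; apply: contrapT => nnear; apply: nex.
    exists i; split=> // m; apply: contrapT => nk; apply: nnear.
    by exists m => // k /= mk Hk; apply: nk; exists k.
  have /AH[i i_n] := NA (maxn N M) (leq_maxl N M).
  by apply: (MP (maxn N M) (leq_maxr N M)).
have /choice[c cP] : forall x, exists i,
    subset_mod_fin (range (u x)) A -> (i < n)%N /\
    forall m, exists2 k, (m <= k)%N & H i (u x k).
  move=> x; have [/branch[i]|] := pselect (subset_mod_fin (range (u x)) A).
    by exists i.
  by exists 0.
apply: (@card_le_finite _ _ _ `I_n) => //.
apply: (@card_le_inj _ _ _ _ c) => [x /cP[]//|x y /cP[cx xH] /cP[_ yH] cxy].
rewrite -{}cxy in yH; apply/funext => i.
have [k ik Hk] := xH i.+1.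
have ukl l : (i < l)%N -> H (c x) (u y l) -> u x k <> u y l ->
    E (u x k) (u y l) -> x i = y i.
  move=> il _ kl; rewrite eE; last by move=> e_kl; apply: kl; rewrite /u e_kl.
  by move=> /comparable_mkseq; apply.
have [l il Hl] := yH i.+1.
have [ukl_eq|ukl_neq] := pselect (u x k = u y l).
  have xy : mkseq x k = mkseq y l by exact: e_inj.
  by apply: (@comparable_mkseq x y k l) => //; rewrite xy /comparable_nodes prefix_refl.
(* In a clique the two deep nodes are comparable, so [x i = y i]; an independent set cannot contain
   two nodes of one branch. *)
have [Hclq|Hind] := Hhom _ cx; first by apply: (ukl l) => //; exact: Hclq.
have [k' kk' Hk'] := xH k.+1.
have kk'_neq : u x k <> u x k' by move=> /u_inj e_kk'; rewrite e_kk' ltnn in kk'.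
by have /negP[] := Hind _ _ Hk Hk' kk'_neq; apply: u_clique.
Qed.

(** * Solecki's ideal *)

Lemma second_countable_cantor_space : second_countable (T := cantor_space).
Proof.
exists (range cylinder); first exact: card_le_trans (card_image_le _ _) (countableP _).
split=> [_ [s _ <-]|x U /nbhs_cylinder[n nU]]; first by have [] := clopen_cylinder s.
exists (cylinder (mkseq x n)) => //; split; first by exists (mkseq x n).
exact: cylinder_mkseq.
Qed.

Definition flip (N : nat) (x : nat -> bool) : nat -> bool :=
  fun i => if i == N then ~~ x i else x i.

Lemma cylinder_flip (N : nat) (s : seq bool) (x : cantor_space) :
  cylinder s (flip N x) ->
  cylinder (mkseq (flip N (nth false s)) (size s)) x.
Proof.
move=> /cylinderP sx; apply/cylinder_mkseqP => i si.
by have := sx i si; rewrite /flip; case: eqP => // _ <-; rewrite negbK.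
Qed.

Section cantor_measure.
Variable R : realType.

Definition weight (s : seq bool) : R := 2^-1 ^+ size s.

Lemma weight_gt0 (s : seq bool) : 0 < weight s.
Proof. by rewrite exprn_gt0. Qed.

(** By induction on the greatest length. Unless the empty sequence is present, with weight 1, the
    tails of the sequences starting with a given bit cover the space again, and weigh twice as much
    as these sequences. *)
Lemma cover_weight_ge1 (l : seq (seq bool)) :
  (forall x, exists2 s, s \in l & cylinder s x) -> 1 <= \sum_(s <- l) weight s.
Proof.
have [n ln] : exists n, forall s, s \in l -> (size s <= n)%N.
  exists (\max_(s <- l) size s) => s sl; exact: leq_bigmax_seq.
elim: n l ln => [|n IHn] l ln lcov.
all: have [nl|nl] := boolP ([::] \in l); first by
  rewrite (big_rem _ nl) /= {1}/weight expr0 lerDl sumr_ge0// => s _;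
  exact/ltW/weight_gt0.
  have [s sl _] := lcov xpredT; move: (ln s sl).
  by rewrite leqn0 size_eq0 => /eqP s0; rewrite -s0 sl in nl.
have nnil s : s \in l -> s != [::] by apply: contraTneq => ->.
pose tails b := [seq behead s | s <- l & (nth false s 0 == b) && (s != [::])].
have sum_tails b : \sum_(s <- l | nth false s 0 == b) weight s =
    2^-1 * \sum_(s <- tails b) weight s.
  rewrite big_map big_filter mulr_sumr big_seq_cond [RHS]big_seq_cond.
  apply: eq_big => [s|s /andP[sl _]].
    by have [/nnil ->|//] := boolP (s \in l); rewrite andbT.
  by case: s sl => [/nnil//|c s _]; rewrite /weight /= exprS.
have tails_ge1 b : 1 <= \sum_(s <- tails b) weight s.
  apply: IHn => [s /mapP[s' + ->]|x].
    rewrite mem_filter => /andP[_ /ln]; rewrite size_behead.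
    by case: (size s').
  have [s sl /cylinderP xs] :=
    lcov (fun i => if i is j.+1 then x j else b).
  exists (behead s).
    apply/mapP; exists s => //; rewrite mem_filter sl andbT.
    by rewrite nnil// andbT; case: s sl xs => [/nnil//|c s _ <-].
  apply/cylinderP => i; rewrite size_behead nth_behead -ltnS.
  by case: s sl xs => [/nnil//|c s _ xs]; exact: (xs i.+1).
rewrite (bigID (fun s => nth false s 0 == true)) /= sum_tails.
rewrite (eq_bigl (fun s => nth false s 0 == false)); last first.
  by move=> s; case: (nth _ _ _).
rewrite sum_tails; have := tails_ge1 true; have := tails_ge1 false; lra.
Qed.

(** Adding the flip of every cylinder of [l] doubles the weight and covers the whole space. *)
Lemma cover_weight_ge_half (N : nat) (U : set cantor_space)
    (l : seq (seq bool)) :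
  (forall x : cantor_space, U x \/ U (flip N x)) ->
  (forall x, U x -> exists2 s, s \in l & cylinder s x) ->
  2^-1 <= \sum_(s <- l) weight s.
Proof.
move=> UN Ul; pose fl s := mkseq (flip N (nth false s)) (size s).
have := @cover_weight_ge1 (l ++ map fl l); rewrite big_cat big_map /=.
rewrite [X in _ + X](eq_bigr weight) => [cov1|s _]; last first.
  by rewrite /weight size_mkseq.
suff /cov1 : forall x, exists2 s, s \in l ++ map fl l & cylinder s x by lra.
move=> x; have [/Ul[s sl sx]|/Ul[s sl /cylinder_flip sx]] := UN x.
  by exists s => //; rewrite mem_cat sl.
by exists (fl s) => //; rewrite mem_cat map_f ?orbT.
Qed.

(** The outer measure uses infinite covers, so a finite list is padded with ever smaller cylinders,
    of total weight at most [2 * 2^-1 ^+ L]. *)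
Lemma partial_weight_le (l : seq (seq bool)) (L n : nat) :
  \sum_(0 <= k < n) weight (nth (nseq (L + k) true) l k) <=
  \sum_(s <- l) weight s + 2 * 2^-1 ^+ L.
Proof.
have halfX_ge0 m : 0 <= 2^-1 ^+ m :> R by rewrite exprn_ge0.
elim: l L n => [|s l IHl] L n.
  rewrite big_nil add0r.
  suff : \sum_(0 <= k < n) weight (nth (nseq (L + k) true) [::] k) <=
      2 * 2^-1 ^+ L - 2 * 2^-1 ^+ (L + n).
    by have := halfX_ge0 (L + n)%N; lra.
  elim: n => [|n IHn]; first by rewrite big_geq// addn0 subrr.
  rewrite big_nat_recr//= nth_nil /weight size_nseq addnS exprS.
  by have := halfX_ge0 (L + n)%N; lra.
case: n => [|n].
  rewrite big_geq// addr_ge0// ?mulr_ge0// sumr_ge0// => t _.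
  exact/ltW/weight_gt0.
rewrite big_nat_recl//= big_cons -addrA lerD2l.
under eq_bigr do rewrite -addSnnS.
apply: le_trans (IHl L.+1 n) _; rewrite lerD2l exprS.
by have := halfX_ge0 L; lra.
Qed.

Lemma cantor_measure_le (U : set cantor_space) (l : seq (seq bool)) :
  (forall x, U x -> exists2 s, s \in l & cylinder s x) ->
  (cantor_measure R U <= (\sum_(s <- l) weight s)%:E)%E.
Proof.
move=> Ul; apply/lee_addgt0Pr => e e0.
have [L Le] : exists L, 2 * 2^-1 ^+ L <= e :> R.
  have half_lt1 : `|2^-1 : R| < 1 by rewrite ger0_norm// invf_lt1// ltr1n.
  have /cvgrPdist_lt/(_ (e / 2))[|L _ /(_ L (leqnn L))] := cvg_expr half_lt1.
    by rewrite divr_gt0.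
  by rewrite /= sub0r normrN ger0_norm ?exprn_ge0// => ?; exists L; lra.
apply: ge_ereal_inf.
exists (\sum_(0 <= k <oo) (weight (nth (nseq (L + k) true) l k))%:E)%E.
  exists (fun k => nth (nseq (L + k) true) l k) => // x /Ul[s sl sx].
  by exists (index s l) => //; rewrite nth_index.
apply: lime_le.
  by apply: is_cvg_nneseries => k _ _; rewrite lee_fin ltW// weight_gt0.
exists 0 => // n _; rewrite sumEFin -EFinD lee_fin.
by apply: le_trans (partial_weight_le l L n) _; rewrite lerD2l.
Qed.

(** By compactness, a countable cover by cylinders has a finite subcover, contained in an initial
    segment of the cover. *)
Lemma cantor_measure_ge (U : set cantor_space) (c : R) : closed U ->
  (forall l, (forall x, U x -> exists2 s, s \in l & cylinder s x) ->
     c <= \sum_(s <- l) weight s) ->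
  (c%:E <= cantor_measure R U)%E.
Proof.
move=> Uclosed Uc; apply/ereal_infP => _ [s Us <-].
have : compact U by exact: subclosed_compact Uclosed cantor_space_compact _.
rewrite compact_cover => /(_ _ setT (fun k => cylinder (s k)))[|//|D _ UD].
  by move=> k _; have [] := clopen_cylinder (s k).
have [M DM] := finite_nat_bound (finite_fset D).
apply: (@le_trans _ _ (\sum_(0 <= k < M.+1) (weight (s k))%:E)%E); last first.
  by apply: nneseries_lim_ge => k _ _; rewrite lee_fin ltW// weight_gt0.
rewrite sumEFin lee_fin -(big_map s xpredT weight); apply: Uc => x /UD[k kD sx].
by exists (s k) => //; rewrite map_f// mem_index_iota ltnS DM.
Qed.

(* Flipping the [N]-th coordinate exchanges this set and its complement. *)
Definition half_set (N : nat) (c : seq bool -> bool) : set cantor_space :=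
  [set x | x N = c (mkseq x N)].

Lemma open_half_set (N : nat) (c : seq bool -> bool) : open (half_set N c).
Proof.
rewrite openE => x xc.
apply: filterS (cylinder_nbhs (cylinder_mkseq x N.+1)) => y /cylinder_mkseqP yx.
rewrite /half_set /= yx// xc; congr c.
apply: (@eq_from_nth _ false); rewrite !size_mkseq// => i iN.
by rewrite !nth_mkseq// yx// ltnW.
Qed.

Lemma closed_half_set (N : nat) (c : seq bool -> bool) : closed (half_set N c).
Proof.
rewrite -openC (_ : ~` _ = half_set N (negb \o c)); first exact: open_half_set.
apply/seteqP; split=> x; rewrite /half_set /=; last by move=> ->; case: (c _).
by case: (x N) (c _) => [] [].
Qed.

Lemma half_set_Omega (N : nat) (c : seq bool -> bool) :
  Omega R (half_set N c).
Proof.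
split; first by split; [exact: open_half_set | exact: closed_half_set].
apply/eqP; rewrite eq_le; apply/andP; split.
  have <- : \sum_(s <- [seq rcons (tval t) (c t) | t <- enum {:N.-tuple bool}])
      weight s = 2^-1 :> R.
    rewrite big_map big_enum /= (eq_bigr (fun=> 2^-1 ^+ N.+1)) => [|t _].
      rewrite sumr_const card_tuple card_bool -[X in X = _]mulr_natr natrX.
      by rewrite exprS -mulrA -exprMn mulVf// expr1n mulr1.
    by rewrite /weight size_rcons size_tuple.
  apply: cantor_measure_le => x xc.
  exists (rcons (mkseq x N) (c (mkseq x N))).
    apply/mapP; exists (tcast (size_mkseq x N) (in_tuple (mkseq x N))).
      by rewrite mem_enum.
    by rewrite val_tcast.
  by rewrite -xc -mkseqS; exact: cylinder_mkseq.
apply: cantor_measure_ge; first exact: closed_half_set.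
move=> l; apply: (@cover_weight_ge_half N) => x.
have -> : half_set N c (flip N x) = (~~ x N = c (mkseq x N)).
  rewrite /half_set /= /flip eqxx; congr (_ = c _).
  apply: (@eq_from_nth _ false); rewrite !size_mkseq// => i iN.
  by rewrite !nth_mkseq// ltn_eqF.
by rewrite /half_set /=; case: (x N) (c _) => [] []; [left|right|right|left].
Qed.

(** The set is nonempty, its measure not being 0, and open in a space without isolated points. *)
Lemma Omega_point_neq (V : Omega R) (x : cantor_space) :
  exists2 z, set_val V z & z <> x.
Proof.
have [[Vopen _] Vmeas] : Omega R (set_val V) by exact: set_valP.
have [v Vv] : set_val V !=set0.
  apply/set0P/eqP => V0; have := @cantor_measure_le (set_val V) [::].
  by rewrite Vmeas V0 big_nil lee_fin => /(_ (fun=> False_ind _)); lra.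
have [vx|] := pselect (v = x); last by exists v.
have [n nV] := nbhs_cylinder (open_nbhs_nbhs (conj Vopen Vv)).
exists (flip n v).
  by apply/nV/cylinder_mkseqP => i ni; rewrite /flip ltn_eqF.
by rewrite -vx => /(congr1 (fun y => y n)); rewrite /flip eqxx; case: (v n).
Qed.

Lemma near_separated (s : seq cantor_space) :
  \forall N \near \oo, forall x y, x \in s -> y \in s ->
    mkseq x N = mkseq y N -> x = y.
Proof.
have [N _ NP] : \forall N \near \oo, forall i, (i < size s)%N ->
    forall j, (j < size s)%N ->
    mkseq (nth point s i) N = mkseq (nth point s j) N ->
    nth point s i = nth point s j.
  apply: near_all_lt => i _; apply: near_all_lt => j _.
  have [->|xy] := pselect (nth point s i = nth point s j); first by exists 0.
  have [m xym] : exists m, nth point s i m <> nth point s j m.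
    apply: contrapT => nex; apply: xy; apply/funext => m.
    by apply: contrapT => xym; apply: nex; exists m.
  exists m.+1 => // N /= mN /(congr1 (fun t => nth false t m)).
  by rewrite !nth_mkseq.
exists N => // n /NP nP x y xs ys.
have := nP (index x s) _ (index y s).
by rewrite !index_mem !nth_index//; exact.
Qed.

Lemma Omega_separation (x : cantor_space) (s : seq cantor_space) :
  x \notin s -> exists2 U : Omega R, set_val U x &
    forall z, z \in s -> ~ set_val U z.
Proof.
move=> xs; have [N _ /(_ N (leqnn N)) sep] := near_separated (x :: s).
pose near_q q (z : cantor_space) := mkseq z N == q.
(* After the restriction of a point of [s], bit [N] must be the opposite of the bit of that point;
   elsewhere it is the bit of [x]. There is no conflict as restrictions to [N] separate the
   points. *)
pose c q := if has (near_q q) s then ~~ (nth point s (find (near_q q) s)) N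
            else x N.
exists (SigSub (mem_set (half_set_Omega N c))) => [|z zs].
  change (x N = c (mkseq x N)); rewrite /c; case: ifPn => // /hasP[z zs /eqP zx].
  have e : z = x by apply: sep => //; rewrite inE ?zs ?eqxx ?orbT.
  by rewrite -e zs in xs.
have hz : has (near_q (mkseq z N)) s by apply/hasP; exists z; rewrite // /near_q.
change (z N <> c (mkseq z N)); rewrite /c hz.
have /eqP := nth_find point hz; set y := nth _ _ _ => yz.
have -> : y = z.
  by apply: sep => //; rewrite inE ?zs ?orbT// mem_nth ?orbT// -has_find.
by case: (z N).
Qed.

(** Adjoining to [s] a point other than [x] of each [V] in [E] forces [U] to differ from every
    [V]. *)
Lemma Omega_separation_fin (x : cantor_space) (s : seq cantor_space)
    (E : set (Omega R)) :
  x \notin s -> finite_set E -> exists2 U, set_val U x /\ ~ E U &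
    forall z, z \in s -> ~ set_val U z.
Proof.
move=> xs /finite_seqP[l ->].
have /choice[p pP] : forall V : Omega R, exists z, set_val V z /\ z <> x.
  by move=> V; have [z] := Omega_point_neq V x; exists z.
have [|U Ux Us] := @Omega_separation x (s ++ map p l).
  rewrite mem_cat negb_or xs /=; apply/negP => /mapP[V _ xV].
  by have [_] := pP V; rewrite -xV.
exists U => [|z zs]; last by apply: Us; rewrite mem_cat zs.
split=> //= Ul; have [pU _] := pP U.
by apply: Us pU; rewrite mem_cat map_f ?orbT.
Qed.

(** An ideal that contains the generators of [solecki_ideal]: a common point of a generator pierces
    it. *)
Definition pierced (A : set (Omega R)) :=
  exists s : seq cantor_space, forall U, A U -> exists2 x, x \in s & set_val U x.

Lemma pierced_ideal : ideal pierced.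
Proof.
split=> [A /finite_seqP[l ->]|A B AB [s sP]|A B [s sP] [t tP]].
- have /choice[p pP] : forall V : Omega R, exists z, set_val V z.
    by move=> V; have [z] := Omega_point_neq V point; exists z.
  by exists (map p l) => U /= Ul; exists (p U) => //; exact: map_f.
- by exists s => U /AB/sP.
by exists (s ++ t) => U [/sP|/tP] [x xs Ux]; exists x; rewrite ?mem_cat ?xs ?orbT.
Qed.

Lemma cof_star_omega_solecki : cof_star_omega (@solecki_ideal R) continuum.
Proof.
apply: (@cof_star_omega_continuum _ _
  (fun x => [set U : Omega R | set_val U (x : cantor_space)])).
- apply: (@sub_countable _ _ _ (Omega R)).
    by have /card_eqPle[] := card_setT (Omega R).
  apply: sub_countable (clopen_countable cantor_space_compact
    second_countable_cantor_space).
  by apply: subset_card_le => U [].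
- by move=> /(@Omega_separation_fin point [::] _ isT)[U [_ nU] _]; exact: nU.
- exact: generated_ideal_set1.
- by move=> x; apply: sub_gen_smallest; exists x.
have sub : @solecki_ideal R `<=` pierced.
  apply: smallest_sub; first exact: pierced_ideal.
  by move=> A [x xA]; exists [:: x] => U /xA; exists x; rewrite ?inE.
move=> A /sub[s sP]; apply: (sub_finite_set _ (finite_seq s)) => x xA /=.
apply/negPn/negP => xs.
(* For [x] outside [s], some [U] contains [x], misses [s] and is not among the finitely many
   exceptions, so it would be a member of [A] that [s] does not pierce. *)
have [U [Ux nU] Us] := Omega_separation_fin xs xA.
apply: nU; split=> // /sP[z zs Uz]; exact: Us Uz.
Qed.

End cantor_measure.

Theorem proposition3p17 (R : realType) :
  [/\ (forall E : rel nat, rado_graph E ->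
         cof_star_omega (random_graph_ideal E) continuum),
      cof_star_omega (@solecki_ideal R) continuum,
      cof_star_omega (@conv_ideal R) continuum
    & [/\ cof_star_omega ED continuum,
          cof_star_omega ED_fin continuum
        & cof_star_omega linear_ideal continuum]] /\
  (exists K : set (nat -> nat),
     dominating_number K /\ cof_star_omega FinxFin K) /\
  (exists K : set (set cantor_space),
     cof (@meager cantor_space) K /\ cof_star_omega nwd K).
Proof.
split; first split.
- exact: cof_star_omega_random_graph.
- exact: cof_star_omega_solecki.
- exact: cof_star_omega_conv.
- split; [exact: cof_star_omega_ED | exact: cof_star_omega_ED_fin |].
  exact: cof_star_omega_linear_ideal.
by split; [exact: cof_star_omega_FinxFin | exact: cof_star_omega_nwd].
Qed.
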